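(* Let $d\in\mathbb{N}$, $n\in\mathbb{N}$ and $f_1,\dots,f_n\in A_{\mathrm{sym}}(\mathbb{D}^d)$. Then the following are equivalent: (1) There exist $g_1,\dots,g_n\in A_{\mathrm{sym}}(\mathbb{D}^d)$ such that $f_1g_1+\cdots+f_ng_n=\mathbf{1}$. (2) There exists a $\delta>0$ such that for all $\mathbf{z}\in\mathbb{D}^d$, $|f_1(\mathbf{z})|+\cdots+|f_n(\mathbf{z})|\geq\delta$.
   Context: $\mathbb{N}=\{1,2,3,\dots\}$, $\mathbb{D}=\{z\in\mathbb{C}:|z|<1\}$, and $\overline{\mathbb{D}}$ is its closure in $\mathbb{C}$. For $d\in\mathbb{N}$, $A(\mathbb{D}^d)$ is the polydisc algebra of all functions $f:\overline{\mathbb{D}}^d\to\mathbb{C}$ that are holomorphic in $\mathbb{D}^d$ and continuous on $\overline{\mathbb{D}}^d$, a Banach algebra with pointwise operations and the norm $\|f\|_\infty=\sup_{\mathbf{z}\in\mathbb{D}^d}|f(\mathbf{z})|$. The symmetric group $S_d$ of all permutations of $\{1,\dots,d\}$ acts by $\sigma\mathbf{z}=(z_{\sigma(1)},\dots,z_{\sigma(d)})$ for $\mathbf{z}=(z_1,\dots,z_d)\in\mathbb{C}^d$. A function $f\in A(\mathbb{D}^d)$ is symmetric if $f(\sigma\mathbf{z})=f(\mathbf{z})$ for all $\mathbf{z}\in\mathbb{D}^d$ and all $\sigma\in S_d$. $A_{\mathrm{sym}}(\mathbb{D}^d)$ is the Banach subalgebra of $A(\mathbb{D}^d)$ consisting of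 all symmetric functions in $A(\mathbb{D}^d)$. $\mathbf{1}$ denotes the constant function with value $1$. *)

(* Defs.v *)
From HB Require Import structures.
From mathcomp Require Import all_boot all_order all_algebra all_fingroup.
From mathcomp Require Import all_classical all_reals all_analysis.
From mathcomp Require Export complex.

Set Implicit Arguments.
Unset Strict Implicit.
Unset Printing Implicit Defensive.

Import Order.TTheory GRing.Theory Num.Theory.
Import numFieldNormedType.Exports.

Local Open Scope classical_set_scope.
Local Open Scope ring_scope.

(* The type [R[i]] itself is not a declared instance of the topological
   structures; packing it as a [numClosedFieldType] gives it the norm topology,
   and gives ['rV[Cplx R]_d] the sup-norm topology, which is the usual topology
   of C^d. *)
Definition Cplx (R : realType) : numClosedFieldType := R[i].

Section PolydiscAlgebra.
Variables (R : realType) (d : nat).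
Local Notation C := (Cplx R).

Definition disc : set C := [set z | `|z| < 1].

Definition polydisc : set 'rV[C]_d := [set z | forall j, disc (z ord0 j)].

Definition closed_polydisc : set 'rV[C]_d :=
  [set z | forall j, closure disc (z ord0 j)].

(* [differentiable] over the scalar field [C] asks for a [C]-linear Fréchet
   derivative. *)
Definition holomorphic_in (U : set 'rV[C]_d) (f : 'rV[C]_d -> C) : Prop :=
  forall z, U z -> differentiable f z.

(* A function on the closed polydisc is represented by a total function on C^d
   whose values off the closed polydisc are irrelevant; accordingly two elements
   of the algebra are equal when they agree on [closed_polydisc]. *)
Definition polydisc_algebra : set ('rV[C]_d -> C) :=
  [set f | holomorphic_in polydisc f /\ {within closed_polydisc, continuous f}].

(* [col_perm s z] is the row vector (z_{s(1)}, ..., z_{s(d)}). *)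
Definition symmetric_fun (f : 'rV[C]_d -> C) : Prop :=
  forall z, polydisc z -> forall s : 'S_d, f (col_perm s z) = f z.

Definition sym_polydisc_algebra : set ('rV[C]_d -> C) :=
  [set f | polydisc_algebra f /\ symmetric_fun f].

End PolydiscAlgebra.

Arguments polydisc {R d}.
Arguments closed_polydisc {R d}.
Arguments polydisc_algebra {R d}.
Arguments sym_polydisc_algebra {R d}.

(* Main.v *)
From HB Require Import structures.
From mathcomp Require Import all_boot all_order all_algebra all_fingroup.
From mathcomp Require Import all_classical all_reals all_analysis.
From mathcomp Require Import ring lra.
Require Import Defs.

(** The implication from a Bezout identity to the lower bound is the boundedness
    of the [g k] on the compact closed polydisc. Conversely it suffices to find
    [g k] in the polydisc algebra, symmetric or not: averaging them over all
    permutations of the variables keeps the Bezout identity, since the [f k] are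
    symmetric. If there are no such [g k], the ideal generated by the [f k] is
    proper, hence is contained in the kernel of a character of the algebra
    ([character_exists]); characters are evaluations at points of the closed
    polydisc ([character_eval]), so the [f k] have a common zero there, which the
    lower bound excludes by continuity.

    Both facts about characters are proved by elementary means.

    A maximal ideal yields a field with a submultiplicative norm, and such a field
    is the field of scalars ([gelfand_mazur]). If [x] differs from all scalars,
    the functions [1 / (1 - (l / x) ^ (2 ^ k))] of [l] are defined everywhere, and
    each of them is a mean of rotations of the one with [k = 0]. So they share a
    Lipschitz constant on discs, while for large [k] they are close to [1] as long
    as [|l|] is small and cannot remain so when [|l|] exceeds the norm of [x].

    Let [phi] be a character and [l] the point with coordinates [phi (z_j)]. By
    dilation it suffices to treat a function holomorphic on a larger polydisc, and
    by changing the coordinates one at a time, to show that [phi] kills the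
    difference [g] between the function and its restriction to [z_j = l_j]. Whether
    [g / (z_j - l_j)] is holomorphic is not obvious for functions that are only
    known to be differentiable once, but [g ^ 2 / (z_j - l_j)] is, because the
    derivative at a zero of [g] is seen on a first order expansion
    ([differentiable_square_quotient]); so [phi g ^ 2 = 0]. In several variables
    that expansion has to be combined with the bound [|g| <= c * |z_j - l_j|],
    which is the Schwarz lemma on slices ([schwarz]).

    The Schwarz lemma comes from the maximum principle on squares
    ([square_max_principle]), applied to [u ^ (n + 1) / (z - p) ^ n]. The maximum
    principle in turn only needs Goursat's theorem ([goursat]), and a version for
    Riemann sums is enough: midpoint sums along the sides of a square add up under
    subdivision and are exact on affine functions, so that the usual argument with
    nested squares shows that they tend to zero. Again the function to which it is
    applied is a square divided by [z - w]. *)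

Set Implicit Arguments.
Unset Strict Implicit.
Unset Printing Implicit Defensive.

Import Order.TTheory GRing.Theory Num.Theory.
Import numFieldNormedType.Exports.

Local Open Scope classical_set_scope.
Local Open Scope ring_scope.

(** * The modulus of a complex number as a real number *)

Section Modulus.
Context {R : realType}.
Local Notation C := (Cplx R).
Implicit Types (z w : C) (x : R).

(** The embedding of the reals with codomain [Cplx R], the type that carries the
    topology. *)
Definition ofR (x : R) : C := (x%:C)%C.
Definition cabs z : R := complex.Re `|z|.

HB.instance Definition _ := GRing.RMorphism.copy ofR (real_complex R).

Lemma normE z : `|z| = ofR (cabs z).
Proof. by rewrite /ofR /cabs RRe_real ?normr_real. Qed.

Lemma ofR_le x y : (ofR x <= ofR y) = (x <= y). Proof. exact: lecR. Qed.
Lemma ofR_lt x y : (ofR x < ofR y) = (x < y). Proof. exact: ltcR. Qed.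
Lemma ofR_inj : injective ofR. Proof. by move=> x y []. Qed.

Lemma ofR_ge0 x : (0 <= ofR x) = (0 <= x).
Proof. by rewrite -ofR_le rmorph0. Qed.
Lemma ofR_gt0 x : (0 < ofR x) = (0 < x).
Proof. by rewrite -ofR_lt rmorph0. Qed.

Lemma cabs_ge0 z : 0 <= cabs z.
Proof. by rewrite -ofR_le -normE rmorph0. Qed.

Lemma cabs0 : cabs 0 = 0.
Proof. by apply: ofR_inj; rewrite -normE normr0 rmorph0. Qed.

Lemma cabs1 : cabs 1 = 1.
Proof. by apply: ofR_inj; rewrite -normE normr1 rmorph1. Qed.

Lemma cabs_eq0 z : (cabs z == 0) = (z == 0).
Proof. by rewrite -[RHS]normr_eq0 normE -(inj_eq ofR_inj) rmorph0. Qed.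

Lemma cabs_gt0 z : (0 < cabs z) = (z != 0).
Proof. by rewrite lt_neqAle cabs_ge0 andbT eq_sym cabs_eq0. Qed.

Lemma cabsM z w : cabs (z * w) = cabs z * cabs w.
Proof. by apply: ofR_inj; rewrite rmorphM -!normE normrM. Qed.

Lemma cabsX z n : cabs (z ^+ n) = cabs z ^+ n.
Proof. by apply: ofR_inj; rewrite rmorphXn -!normE normrX. Qed.

Lemma cabsV z : cabs z^-1 = (cabs z)^-1.
Proof. by apply: ofR_inj; rewrite fmorphV -!normE normfV. Qed.

Lemma cabsN z : cabs (- z) = cabs z.
Proof. by apply: ofR_inj; rewrite -!normE normrN. Qed.

Lemma cabsB z w : cabs (z - w) = cabs (w - z).
Proof. by rewrite -cabsN opprB. Qed.

Lemma cabsD z w : cabs (z + w) <= cabs z + cabs w.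
Proof. by rewrite -ofR_le rmorphD -!normE ler_normD. Qed.

Lemma cabs_ofR x : cabs (ofR x) = `|x|.
Proof.
apply: ofR_inj; rewrite -normE; case: (lerP 0 x) => h.
  by rewrite !ger0_norm // ofR_ge0.
by rewrite !ltr0_norm ?rmorphN // -oppr_gt0 -rmorphN ofR_gt0 oppr_gt0.
Qed.

Lemma cabs_real x : 0 <= x -> cabs (ofR x) = x.
Proof. by move=> ?; rewrite cabs_ofR ger0_norm. Qed.

Lemma cabs_sum (I : Type) (r : seq I) (P : pred I) (F : I -> C) :
  cabs (\sum_(i <- r | P i) F i) <= \sum_(i <- r | P i) cabs (F i).
Proof.
elim/big_ind2: _ => [|x1 x2 y1 y2 h1 h2|//]; first by rewrite cabs0.
by rewrite (le_trans (cabsD _ _)) // lerD.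
Qed.

Lemma cabs_ge_Re z : `|complex.Re z| <= cabs z.
Proof. by rewrite -lecR [leRHS]RRe_real ?normr_real // normc_ge_Re. Qed.

Lemma cabs_ge_Im z : `|complex.Im z| <= cabs z.
Proof.
have := cabs_ge_Re ('i%C * z); rewrite mulrC ReiNIm normrN mulrC.
suff -> : cabs ('i%C * z) = cabs z by [].
rewrite cabsM -[X in X * _](_ : 1 = _) ?mul1r //.
by apply: ofR_inj; rewrite -normE normc_def /= expr0n expr1n add0r sqrtr1.
Qed.

Lemma complexRI z : z = ofR (complex.Re z) + 'i%C * ofR (complex.Im z).
Proof. exact: complexE. Qed.

Lemma cabs_i : cabs 'i%C = 1.
Proof. by apply: ofR_inj; rewrite -normE normc_def /= expr0n expr1n add0r sqrtr1. Qed.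

Lemma cabs_le_ReIm z : cabs z <= `|complex.Re z| + `|complex.Im z|.
Proof.
rewrite {1}[z]complexRI (le_trans (cabsD _ _)) // cabsM cabs_i mul1r.
by rewrite !cabs_ofR.
Qed.

Lemma nbhs_cabsP (p : C) (A : set C) :
  nbhs p A <-> exists2 e, 0 < e & forall z, cabs (z - p) < e -> A z.
Proof.
split=> [/nbhs_ballP [e /= e0 eA]|[e e0 eA]].
  exists (complex.Re e).
    by rewrite -ofR_lt rmorph0 [ofR _]RRe_real // gtr0_real.
  move=> z zp; apply: eA; rewrite -ball_normE /= distrC normE.
  by rewrite -[e]RRe_real ?gtr0_real // ofR_lt.
apply/nbhs_ballP; exists (ofR e); first by rewrite /= ofR_gt0.
by move=> z; rewrite -ball_normE /= distrC normE ofR_lt => /eA.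
Qed.

End Modulus.

(** * Topology of the plane and of the closed polydisc *)

Section Topology.
Context {R : realType}.
Local Notation C := (Cplx R).

Lemma cabs_continuous : continuous (@cabs R : C -> R).
Proof.
move=> p A /nbhs_ballP [e /= e0 eA]; apply/nbhs_cabsP; exists e => // z zp.
apply: eA; rewrite -ball_normE /= distrC; apply: le_lt_trans zp; rewrite ler_norml.
have h1 := cabsD (z - p) p; have h2 := cabsD (p - z) z.
rewrite !subrK in h1 h2; rewrite cabsB in h2.
apply/andP; split; lra.
Qed.

Lemma compact_closed_disc (r : R) : compact [set z : C | cabs z <= r].
Proof.
pose f (x : R * R) : C := ofR x.1 + 'i%C * ofR x.2.
apply: (@subclosed_compact _ _ (f @` (`[- r, r] `*` `[- r, r]))).
- apply: (@closed_comp _ _ (@cabs R) [set y | y <= r]); last exact: closed_le.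
  by move=> z _; exact: cabs_continuous.
- apply: continuous_compact; last by apply: compact_setX; exact: segment_compact.
  apply: continuous_subspaceT => -[x y] A /nbhs_cabsP [e e0 eA].
  have e2 : 0 < e / 2 by rewrite divr_gt0.
  exists (ball x (e / 2), ball y (e / 2)) => /=.
    by split; apply: nbhsx_ballx.
  move=> [x' y'] [/= bx by_]; apply: eA.
  have -> : f (x', y') - f (x, y) = ofR (x' - x) + 'i%C * ofR (y' - y).
    by rewrite /f !rmorphB /=; ring.
  rewrite (le_lt_trans (cabsD _ _)) // cabsM cabs_i mul1r !cabs_ofR.
  by move: bx by_; rewrite -!ball_normE /= => bx by_; rewrite (splitr e) ltrD // distrC.
- move=> z /= zr; exists (complex.Re z, complex.Im z); last by rewrite [RHS]complexRI.
  split; rewrite /= in_itv /= -ler_norml (le_trans _ zr) //.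
    exact: cabs_ge_Re.
  exact: cabs_ge_Im.
Qed.

Context {d : nat}.
Implicit Types p z : 'rV[C]_d.

Lemma nbhs_rvP p (A : set 'rV[C]_d) :
  nbhs p A <-> exists2 e, 0 < e &
    forall z, (forall j, cabs (z ord0 j - p ord0 j) < e) -> A z.
Proof.
split=> [/nbhs_ballP [e /= e0 eA]|[e e0 eA]].
  have er : ofR (complex.Re e) = e by rewrite [LHS]RRe_real // gtr0_real.
  exists (complex.Re e); first by rewrite -ofR_gt0 er.
  move=> z zp; apply: eA; split=> // i j; rewrite ord1 -ball_normE /= distrC.
  by rewrite normE -er ofR_lt.
apply/nbhs_ballP; exists (ofR e); first by rewrite /= ofR_gt0.
move=> z [_ zp]; apply: eA => j; move: (zp ord0 j); rewrite -ball_normE /=.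
by rewrite distrC normE ofR_lt.
Qed.

Lemma continuous_rvP (f : 'rV[C]_d -> C) p (D : set 'rV[C]_d) :
  (f @ within D (nbhs p) --> f p) <->
  (forall e, 0 < e -> exists2 r, 0 < r & forall z, D z ->
     (forall j, cabs (z ord0 j - p ord0 j) < r) -> cabs (f z - f p) < e).
Proof.
split=> [fc e e0|fc A /nbhs_cabsP [e e0 eA]].
  have : nbhs (f p) [set w : C | cabs (w - f p) < e].
    by apply/nbhs_cabsP; exists e.
  by move/fc => /nbhs_rvP [r r0 rA]; exists r => // z Dz zp; exact: rA.
have [r r0 rA] := fc e e0; apply/nbhs_rvP; exists r => // z zp Dz.
by apply: eA; exact: rA.
Qed.

Lemma polydiscE z : polydisc z <-> forall j, cabs (z ord0 j) < 1.
Proof.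
by split=> h j; have := h j; rewrite /disc /= normE -(rmorph1 (@ofR R)) ofR_lt.
Qed.

Lemma closure_disc (w : C) : closure (disc (R:=R)) w <-> cabs w <= 1.
Proof.
split=> [|w1].
  apply: contraPP => /negP; rewrite -ltNge => w1 /(_ [set v : C | cabs (v - w) < cabs w - 1]) [].
    by apply/nbhs_cabsP; exists (cabs w - 1) => //; rewrite subr_gt0.
  move=> v []; rewrite /disc /= normE -(rmorph1 (@ofR R)) ofR_lt => v1 vw.
  have := cabsD (v - w) (- v); rewrite (_ : _ - v = - w); last ring.
  by rewrite !cabsN; lra.
move=> A /nbhs_cabsP [e e0 eA].
pose t := Num.max (1 - e / 2) 0.
have t0 : 0 <= t by rewrite le_max lexx orbT.
have t1 : t < 1 by rewrite gt_max ltr01 andbT; lra.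
have te : 1 - e / 2 <= t by rewrite le_max lexx.
have w0 := cabs_ge0 w.
exists (ofR t * w); split.
  rewrite /disc /= normE -(rmorph1 (@ofR R)) ofR_lt cabsM cabs_real //; nra.
apply: eA; rewrite -{2}[w]mul1r -(rmorph1 (@ofR R)) -mulrBl -rmorphB cabsM cabs_ofR.
by rewrite ler0_norm; nra.
Qed.

Lemma closed_polydiscE z : closed_polydisc z <-> forall j, cabs (z ord0 j) <= 1.
Proof. by split=> h j; have := h j; rewrite closure_disc. Qed.

Lemma compact_closed_polydisc : compact (@closed_polydisc R d).
Proof.
have -> : @closed_polydisc R d =
    [set v : 'rV[C]_d | forall i, [set z : C | cabs z <= 1] (v ord0 i)].
  by apply/seteqP; split=> z /closed_polydiscE.
by apply: (@rV_compact C d (fun=> [set z : C | cabs z <= 1])) => _; exact: compact_closed_disc.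
Qed.

Lemma sub_closed_polydisc : @polydisc R d `<=` closed_polydisc.
Proof. by move=> z /polydiscE h; apply/closed_polydiscE => j; exact: ltW. Qed.

Lemma polydisc_shrink (t : R) z : 0 <= t < 1 -> closed_polydisc z ->
  polydisc (ofR t *: z).
Proof.
move=> /andP[t0 t1] /closed_polydiscE h; apply/polydiscE => j.
by rewrite mxE cabsM cabs_real //; have := h j; have := cabs_ge0 (z ord0 j); nra.
Qed.

Lemma shrink_dist (t : R) z : 0 <= t <= 1 -> closed_polydisc z ->
  forall j, cabs ((ofR t *: z) ord0 j - z ord0 j) <= 1 - t.
Proof.
move=> /andP[t0 t1] /closed_polydiscE h j.
rewrite mxE -{2}[z _ _]mul1r -(rmorph1 (@ofR R)) -mulrBl -rmorphB cabsM cabs_ofR.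
by rewrite ler0_norm; have := h j; have := cabs_ge0 (z ord0 j); nra.
Qed.

Lemma polydisc_dense z (A : set 'rV[C]_d) : closed_polydisc z -> nbhs z A ->
  exists2 y, polydisc y & A y.
Proof.
move=> zD /nbhs_rvP [s s0 sA].
pose t := Num.max (1 - s / 2) 0.
have t0 : 0 <= t by rewrite le_max lexx orbT.
have t1 : t < 1 by rewrite gt_max ltr01 andbT; lra.
have te : 1 - s / 2 <= t by rewrite le_max lexx.
exists (ofR t *: z); first by apply: polydisc_shrink => //; rewrite t0.
apply: sA => j; have : cabs ((ofR t *: z) ord0 j - z ord0 j) <= 1 - t.
  by apply: shrink_dist => //; rewrite t0 ltW.
by lra.
Qed.

Lemma closed_polydisc_bounded (f : 'rV[C]_d -> C) :
  {within closed_polydisc, continuous f} ->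
  exists2 M, 0 <= M & forall z, closed_polydisc z -> cabs (f z) <= M.
Proof.
move=> /subspace_continuousP fc.
have := compact_closed_polydisc => /compact_near_coveringP/near_covering_withinP.
move=> /(_ R +oo%R (fun M z => cabs (f z) <= M) _)[z zD|M [_ h]].
- have /continuous_rvP/(_ _ ltr01) [s s0 sA] := fc z zD.
  exists ([set z' : 'rV[C]_d | forall j, cabs (z' ord0 j - z ord0 j) < s], [set M : R | cabs (f z) + 1 < M]).
    split; first by apply/nbhs_rvP; exists s.
    by exists (cabs (f z) + 1); split => //; apply: num_real.
  move=> [z' M] [/= h hM] z'D; have := sA _ z'D h.
  by have := cabsD (f z' - f z) (f z); rewrite subrK; lra.
exists (Num.max M 0 + 1); first by rewrite addr_ge0 // le_max lexx orbT.
move=> z zD; apply: h => //; rewrite (@le_lt_trans _ _ (Num.max M 0)) ?ltrDl //.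
by rewrite le_max lexx.
Qed.

(** Uniform continuity on the compact closed polydisc, in the form that lets a
    function of the algebra be replaced by one that is holomorphic on a larger
    polydisc. *)
Lemma dilation_approx (f : 'rV[C]_d -> C) (e : R) :
  {within closed_polydisc, continuous f} -> 0 < e ->
  exists2 t, 0 < t < 1 &
    forall z, closed_polydisc z -> cabs (f z - f (ofR t *: z)) <= e.
Proof.
move=> /subspace_continuousP fc e0.
have := compact_closed_polydisc => /compact_near_coveringP/near_covering_withinP.
move=> /(_ R (nbhs (0 : R)) (fun s z => 0 <= s <= 1 -> cabs (f z - f (ofR (1 - s) *: z)) <= e) _).
case=> [z zD|s /= s0 h].
- have e2 : 0 < e / 2 by rewrite divr_gt0.
  have /continuous_rvP/(_ _ e2) [s s0 sA] := fc z zD.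
  exists ([set z' : 'rV[C]_d | forall j, cabs (z' ord0 j - z ord0 j) < s / 2], ball 0 (s / 2)).
    split; first by apply/nbhs_rvP; exists (s / 2); rewrite ?divr_gt0.
    by apply: nbhsx_ballx; rewrite divr_gt0.
  move=> [z' t] /= [h]; rewrite -ball_normE /= sub0r normrN => ts z'D t1.
  have tt : 0 <= 1 - t <= 1 by apply/andP; split; lra.
  have tD : closed_polydisc (ofR (1 - t) *: z').
    apply/closed_polydiscE => j; rewrite mxE cabsM cabs_real; last by case/andP: tt.
    have /closed_polydiscE/(_ j) := z'D; have := cabs_ge0 (z' ord0 j); nra.
  have d1 : cabs (f z' - f z) < e / 2 by apply: sA => // j; have := h j; lra.
  have d2 : cabs (f (ofR (1 - t) *: z') - f z) < e / 2.
    apply: sA => // j.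
    have := cabsD ((ofR (1 - t) *: z') ord0 j - z' ord0 j) (z' ord0 j - z ord0 j).
    rewrite addrA subrK; have := h j; have := shrink_dist tt z'D j.
    by have := ler_norm t; lra.
  rewrite cabsB in d2.
  have := cabsD (f z' - f z) (f z - f (ofR (1 - t) *: z')).
  by rewrite addrA subrK; lra.
exists (1 - Num.min s 1 / 2).
  have : 0 < Num.min s 1 by rewrite lt_min s0 ltr01.
  have : Num.min s 1 <= 1 by rewrite ge_min lexx orbT.
  by move=> *; apply/andP; split; lra.
have m0 : 0 < Num.min s 1 by rewrite lt_min s0 ltr01.
have m1 : Num.min s 1 <= 1 by rewrite ge_min lexx orbT.
have ms : Num.min s 1 <= s by rewrite ge_min lexx.
move=> z zD; apply: (h (Num.min s 1 / 2)) => //; last by apply/andP; split; lra.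
by rewrite /= sub0r normrN ger0_norm; lra.
Qed.

End Topology.

(** * Goursat's theorem for midpoint sums *)

Section MidpointSums.
Variables (C : numFieldType) (imag : C).
Implicit Types (F G : C -> C) (c v z w p : C).

(** The midpoint Riemann sum of [F] over the segment from [c] to [c + v], cut
    into [2 ^ N] equal pieces; the recursion makes halving a segment a
    computation. *)
Fixpoint edge (N : nat) F c v : C :=
  if N is N'.+1 then edge N' F c (v / 2) + edge N' F (c + v / 2) (v / 2)
  else F (c + v / 2) * v.

(** The sum around the square with corner [c] and sides [v] and [imag * v],
    counterclockwise when [imag] is the imaginary unit. *)
Definition contour N F c v : C :=
  edge N F c v + edge N F (c + v) (imag * v)
  - edge N F (c + imag * v) v - edge N F c (imag * v).

(** The contributions of the sides inside the square cancel. *)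
Lemma contourS N F c v : contour N.+1 F c v =
  contour N F c (v / 2) + contour N F (c + v / 2) (v / 2) +
  contour N F (c + imag * v / 2) (v / 2) +
  contour N F (c + v / 2 + imag * v / 2) (v / 2).
Proof.
rewrite /contour /=.
have hv : v = v / 2 + v / 2 by rewrite -splitr.
have gE : imag * (v / 2) = imag * v / 2 by rewrite mulrA.
have gv : imag * v = imag * v / 2 + imag * v / 2 by rewrite -splitr.
rewrite gE; move: hv gv {gE}; move: (imag * v / 2) => g; move: (imag * v) (v / 2) => iv h -> ->.
rewrite !(addrA c) (addrAC (c + g) g h) (addrAC c g h) (addrAC (c + h) h g).
ring.
Qed.

Lemma edge_add N F G c v :
  edge N (fun z => F z + G z) c v = edge N F c v + edge N G c v.
Proof.
elim: N c v => [|N IH] c v /=; first by rewrite mulrDl.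
by rewrite !IH; ring.
Qed.

Lemma edge_opp N F c v : edge N (fun z => - F z) c v = - edge N F c v.
Proof.
elim: N c v => [|N IH] c v /=; first by rewrite mulNr.
by rewrite !IH; ring.
Qed.

Lemma edge_affine N (a b : C) c v :
  edge N (fun z => a + b * z) c v = (a + b * (c + v / 2)) * v.
Proof.
elim: N c v => [|N IH] c v //=.
by rewrite !IH; field.
Qed.

Lemma contour_add N F G c v :
  contour N (fun z => F z + G z) c v = contour N F c v + contour N G c v.
Proof. by rewrite /contour !edge_add; ring. Qed.

Lemma contour_affine N (a b : C) c v : contour N (fun z => a + b * z) c v = 0.
Proof. by rewrite /contour !edge_affine; field. Qed.

End MidpointSums.

Section Goursat.
Context {R : realType}.
Local Notation C := (Cplx R).
Local Notation Re := (@complex.Re R).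
Local Notation Im := (@complex.Im R).
Implicit Types (F G : C -> C) (c v z w p : C) (s : R).

Definition imag : C := 'i%C.
Local Notation contour := (contour imag).

Lemma cReD z w : Re (z + w) = Re z + Re w. Proof. by case: z; case: w. Qed.
Lemma cImD z w : Im (z + w) = Im z + Im w. Proof. by case: z; case: w. Qed.
Lemma cReN z : Re (- z) = - Re z. Proof. by case: z. Qed.
Lemma cImN z : Im (- z) = - Im z. Proof. by case: z. Qed.
Lemma cReMr s z : Re (ofR s * z) = s * Re z.
Proof. by case: z => a b /=; rewrite mul0r subr0. Qed.
Lemma cImMr s z : Im (ofR s * z) = s * Im z.
Proof. by case: z => a b /=; rewrite mul0r addr0. Qed.
Lemma cReMi z : Re (imag * z) = - Im z.
Proof. by case: z => a b /=; rewrite mul0r mul1r sub0r. Qed.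
Lemma cImMi z : Im (imag * z) = Re z.
Proof. by case: z => a b /=; rewrite mul0r mul1r add0r. Qed.
Lemma Re_ofR s : Re (ofR s) = s. Proof. by []. Qed.
Lemma Im_ofR s : Im (ofR s) = 0. Proof. by []. Qed.

Definition ReIm := (cReD, cImD, cReN, cImN, cReMr, cImMr, cReMi, cImMi, Re_ofR, Im_ofR).

Lemma ofR_half s : ofR (s / 2) = ofR s / 2.
Proof. by rewrite rmorphM fmorphV rmorph_nat. Qed.

Lemma segment_halves c v t : 0 <= t <= 1 ->
  [/\ 0 <= t / 2 <= 1, c + ofR t * (v / 2) = c + ofR (t / 2) * v,
    0 <= (1 + t) / 2 <= 1 &
    c + v / 2 + ofR t * (v / 2) = c + ofR ((1 + t) / 2) * v].
Proof.
move=> /andP[t0 t1]; split.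
- by apply/andP; split; lra.
- by rewrite ofR_half; field.
- by apply/andP; split; lra.
- by rewrite ofR_half rmorphD rmorph1; field.
Qed.

Lemma edge_le N F c v (M : R) :
  (forall t, 0 <= t <= 1 -> cabs (F (c + ofR t * v)) <= M) ->
  cabs (edge N F c v) <= M * cabs v.
Proof.
elim: N c v => [|N IH] c v h /=.
  rewrite cabsM ler_wpM2r ?cabs_ge0 //.
  have -> : c + v / 2 = c + ofR (1 / 2) * v by rewrite ofR_half rmorph1; field.
  by apply: h; apply/andP; split; lra.
apply: (le_trans (cabsD _ _)).
have -> : M * cabs v = M * cabs (v / 2) + M * cabs (v / 2).
  by rewrite cabsM cabsV -(rmorph_nat (@ofR R)) cabs_real ?ler0n //; field.
apply: lerD; apply: IH => t /(segment_halves c v) [t1 e1 t2 e2];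
  rewrite ?e1 ?e2; exact: h.
Qed.

Lemma edge_Im_ge N F c v (k : R) :
  (forall t, 0 <= t <= 1 -> k <= Im (F (c + ofR t * v) * v)) ->
  k <= Im (edge N F c v).
Proof.
elim: N c v k => [|N IH] c v k h /=.
  have -> : c + v / 2 = c + ofR (1 / 2) * v by rewrite ofR_half rmorph1; field.
  by apply: h; apply/andP; split; lra.
have half z : Im (z / 2) = Im z / 2.
  by rewrite mulrC -(rmorph_nat ofR) -fmorphV cImMr mulrC.
rewrite cImD [k]splitr; apply: lerD; apply: IH => t /(segment_halves c v) [t1 e1 t2 e2];
  rewrite ?e1 ?e2 mulrA half; have := h _ t1; have := h _ t2; lra.
Qed.

Definition square c s : set C :=
  [set z | (Re c <= Re z <= Re c + s) && (Im c <= Im z <= Im c + s)].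

Definition square_boundary c s : set C :=
  [set z | square c s z /\ [\/ Re z = Re c, Re z = Re c + s, Im z = Im c | Im z = Im c + s]].

Lemma contour_le N F c s (M : R) : 0 <= s ->
  (forall z, square_boundary c s z -> cabs (F z) <= M) ->
  cabs (contour N F c (ofR s)) <= 4 * M * s.
Proof.
move=> s0 h; rewrite /contour.
have E c' v : cabs v = s -> (forall t, 0 <= t <= 1 -> square_boundary c s (c' + ofR t * v)) ->
    cabs (edge N F c' v) <= M * s.
  by move=> vs b; rewrite -vs; apply: edge_le => t t1; apply: h; exact: b.
have cs : cabs (ofR s) = s by rewrite cabs_real.
have ci : cabs (imag * ofR s) = s by rewrite cabsM cabs_i mul1r.
have e1 : cabs (edge N F c (ofR s)) <= M * s.
  apply: E => // t /andP[t0 t1]; split; last by constructor 3; rewrite !ReIm; lra.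
  by rewrite /square /= !ReIm; apply/andP; split; apply/andP; split; nra.
have e2 : cabs (edge N F (c + ofR s) (imag * ofR s)) <= M * s.
  apply: E => // t /andP[t0 t1]; split; last by constructor 2; rewrite !ReIm; lra.
  by rewrite /square /= !ReIm; apply/andP; split; apply/andP; split; nra.
have e3 : cabs (edge N F (c + imag * ofR s) (ofR s)) <= M * s.
  apply: E => // t /andP[t0 t1]; split; last by constructor 4; rewrite !ReIm; lra.
  by rewrite /square /= !ReIm; apply/andP; split; apply/andP; split; nra.
have e4 : cabs (edge N F c (imag * ofR s)) <= M * s.
  apply: E => // t /andP[t0 t1]; split; last by constructor 1; rewrite !ReIm; lra.
  by rewrite /square /= !ReIm; apply/andP; split; apply/andP; split; nra.
have := cabsD (edge N F c (ofR s) + edge N F (c + ofR s) (imag * ofR s) -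
   edge N F (c + imag * ofR s) (ofR s)) (- edge N F c (imag * ofR s)).
have := cabsD (edge N F c (ofR s) + edge N F (c + ofR s) (imag * ofR s))
   (- edge N F (c + imag * ofR s) (ofR s)).
have := cabsD (edge N F c (ofR s)) (edge N F (c + ofR s) (imag * ofR s)).
by rewrite !cabsN; lra.
Qed.

Definition cdiff F p := exists a, forall e, 0 < e -> exists2 r, 0 < r &
  forall z, cabs (z - p) < r -> cabs (F z - F p - a * (z - p)) <= e * cabs (z - p).

(** The negation of a statement on the limit of the contour sums, in the form that
    passes to one of the four quarters by the pigeonhole principle. *)
Definition frequently_large F c s (k : R) :=
  forall N0, exists2 N, (N0 <= N)%N & k < cabs (contour N F c (ofR s)).

Lemma frequently_large_quarter F c s k : frequently_large F c s k ->
  exists2 c', frequently_large F c' (s / 2) (k / 4) &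
   (Re c' = Re c \/ Re c' = Re c + s / 2) /\ (Im c' = Im c \/ Im c' = Im c + s / 2).
Proof.
move=> L; apply: contrapT => nL.
have small c' : (Re c' = Re c \/ Re c' = Re c + s / 2) ->
    (Im c' = Im c \/ Im c' = Im c + s / 2) ->
    exists N0, forall N, (N0 <= N)%N -> cabs (contour N F c' (ofR (s / 2))) <= k / 4.
  move=> h1 h2; apply: contrapT => h3; apply: nL; exists c' => // N0.
  apply: contrapT => h4; apply: h3; exists N0 => N N0N; rewrite leNgt; apply/negP => h5.
  by apply: h4; exists N.
have [] := small c; [by left|by left|] => N1 h1.
have [] := small (c + ofR (s / 2)); [by right; rewrite !ReIm|by left; rewrite !ReIm addr0|] => N2 h2.
have [] := small (c + imag * ofR (s / 2));
  [by left; rewrite !ReIm oppr0 addr0|by right; rewrite !ReIm|] => N3 h3.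
have [] := small (c + ofR (s / 2) + imag * ofR (s / 2));
  [by right; rewrite !ReIm oppr0 addr0|by right; rewrite !ReIm addr0|] => N4 h4.
have [[//|N]] := L (maxn (maxn N1 N2) (maxn N3 N4)).+1.
rewrite ltnS !geq_max => /andP[/andP[/h1 l1 /h2 l2] /andP[/h3 l3 /h4 l4]].
rewrite contourS -!ofR_half -!mulrA -!ofR_half.
move: l1 l2 l3 l4; set w1 := contour _ _ _ _; set w2 := contour _ _ _ _;
  set w3 := contour _ _ _ _; set w4 := contour _ _ _ _.
have := cabsD (w1 + w2 + w3) w4; have := cabsD (w1 + w2) w3; have := cabsD w1 w2.
lra.
Qed.

(** The common point is given coordinatewise by suprema of lower corners. *)
Lemma nested_squares (c : nat -> C) s : 0 < s ->
  (forall k, let h := s / 2 ^+ k.+1 in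
     (Re (c k.+1) = Re (c k) \/ Re (c k.+1) = Re (c k) + h) /\
     (Im (c k.+1) = Im (c k) \/ Im (c k.+1) = Im (c k) + h)) ->
  exists p, forall k, square (c k) (s / 2 ^+ k) p.
Proof.
move=> s0 nest.
have real_nested (u : nat -> R) :
    (forall k, u k.+1 = u k \/ u k.+1 = u k + s / 2 ^+ k.+1) ->
    exists x, forall k, u k <= x <= u k + s / 2 ^+ k.
  move=> hu.
  have pos k : 0 < s / 2 ^+ k by rewrite divr_gt0 ?exprn_gt0.
  have pw k : s / 2 ^+ k = s / 2 ^+ k.+1 + s / 2 ^+ k.+1.
    by rewrite exprS; field; rewrite expf_neq0.
  have inc : {homo u : n m / (n <= m)%N >-> n <= m}.
    apply: homo_leq => [//|x y z|k]; first exact: le_trans.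
    by case: (hu k) => ->; have := pos k.+1; lra.
  have dec : {homo (fun k => u k + s / 2 ^+ k) : n m / (n <= m)%N >-> n >= m}.
    apply: homo_leq => [//|x y z|k]; first by move=> ? /le_trans; apply.
    by rewrite (pw k); case: (hu k) => ->; have := pos k.+1; lra.
  have ub k m : u m <= u k + s / 2 ^+ k.
    have [mk|/ltnW km] := leqP m k.
      by have := inc _ _ mk; have := pos k; lra.
    by have := dec _ _ km; have := pos m; lra.
  have bu k : ubound (range u) (u k + s / 2 ^+ k) by move=> _ [m _ <-].
  exists (sup (range u)) => k; apply/andP; split.
    by apply: ub_le_sup; [exists (u 0%N + s / 2 ^+ 0) | exists k].
  by apply: ge_sup; [exists (u 0%N); exists 0%N|].
have [x hx] := real_nested (Re \o c) (fun k => (nest k).1).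
have [y hy] := real_nested (Im \o c) (fun k => (nest k).2).
exists (ofR x + imag * ofR y) => k.
have ex : Re (ofR x + imag * ofR y) = x by rewrite cReD cReMi Im_ofR oppr0 addr0.
have ey : Im (ofR x + imag * ofR y) = y by rewrite cImD cImMi Im_ofR add0r.
by apply/andP; rewrite ex ey; split; [exact: hx|exact: hy].
Qed.

Lemma square_dist c s z w : square c s z -> square c s w -> cabs (z - w) <= 2 * s.
Proof.
move=> /andP[/andP[? ?] /andP[? ?]] /andP[/andP[? ?] /andP[? ?]].
rewrite (le_trans (cabs_le_ReIm _)) // !ReIm (_ : 2 * s = s + s); last by ring.
by apply: lerD; rewrite ler_norml; apply/andP; split; lra.
Qed.

(** Halving the square repeatedly while the sums stay large relative to the area
    leads to a point [p]. On a small square around [p] the function is affine up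
    to an error that is small compared with the side, and the sums of the affine
    part vanish: this contradicts the lower bound. *)
Lemma goursat F c s (k : R) : 0 < s -> 0 < k ->
  (forall z, square c s z -> cdiff F z) -> ~ frequently_large F c s k.
Proof.
move=> s0 k0 dF L.
pose T := {x : C * nat | frequently_large F x.1 (s / 2 ^+ x.2) (k / 4 ^+ x.2)}.
have T0 : frequently_large F (c, 0%N).1 (s / 2 ^+ (c, 0%N).2) (k / 4 ^+ (c, 0%N).2).
  by rewrite /= !expr0 !divr1.
pose x0 : T := exist _ (c, 0%N) T0.
have step (x : T) : exists y : T, (sval y).2 = (sval x).2.+1 /\
   let h := s / 2 ^+ (sval x).2.+1 in
   (Re (sval y).1 = Re (sval x).1 \/ Re (sval y).1 = Re (sval x).1 + h) /\
   (Im (sval y).1 = Im (sval x).1 \/ Im (sval y).1 = Im (sval x).1 + h).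
  case: x => -[c1 m] /= Lx.
  have [c' Lc' hc'] := frequently_large_quarter Lx.
  have p2 : s / 2 ^+ m / 2 = s / 2 ^+ m.+1.
    by rewrite exprSr invfM mulrA.
  have p4 : k / 4 ^+ m / 4 = k / 4 ^+ m.+1.
    by rewrite exprSr invfM mulrA.
  rewrite p2 p4 in Lc'; rewrite p2 in hc'.
  by exists (exist _ (c', m.+1) Lc').
pose nx x := sval (cid (step x)).
pose sq m := iter m nx x0.
have sq2 m : (sval (sq m)).2 = m.
  elim: m => //= m IH; rewrite /nx; case: cid => y /= [-> _]; by rewrite IH.
have [|p hp] := @nested_squares (fun m => (sval (sq m)).1) s s0.
  move=> m; have := (svalP (cid (step (sq m)))).2.
  by rewrite -/(nx _) sq2.
have pc : square c s p by have := hp 0%N; rewrite /= expr0 divr1.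
have [a ha] := dF _ pc.
(* The sums on a square of side [h] will be at most [4 * h * (e * (2 * h))], and
   the lower bound there is [k * h ^ 2 / s ^ 2]. *)
have e0 : 0 < k / (8 * s ^+ 2) by rewrite divr_gt0 // mulr_gt0 // exprn_gt0.
have [r r0 hr] := ha _ e0.
pose m := Num.bound (2 * s / r).
pose h := s / 2 ^+ m.
have h0 : 0 < h by rewrite divr_gt0 // exprn_gt0.
have hlt : 2 * h < r.
  have := upper_nthrootP (leqnn m); rewrite ltr_pdivrMr // [X in _ < X]mulrC => ?.
  by rewrite /h mulrA ltr_pdivrMr ?exprn_gt0.
have Lm := svalP (sq m); rewrite sq2 in Lm.
have [N _] := Lm 0%N; rewrite -/h.
set c' := (sval (sq m)).1.
have -> : contour N F c' (ofR h) =
    contour N (fun z => (F p - a * p + a * z) + (F z - F p - a * (z - p))) c' (ofR h).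
  by congr contour; apply/funext => z; ring.
rewrite contour_add contour_affine add0r.
have bd z : square_boundary c' h z ->
    cabs (F z - F p - a * (z - p)) <= k / (8 * s ^+ 2) * (2 * h).
  move=> [zc _]; have zp := square_dist zc (hp m).
  apply: le_trans (hr _ (le_lt_trans zp hlt)) _.
  by rewrite ler_wpM2l // ltW.
have := @contour_le N _ c' h _ (ltW h0) bd.
have -> : 4 * (k / (8 * s ^+ 2) * (2 * h)) * h = k / 4 ^+ m.
  have -> : 4 ^+ m = (2 ^+ m) ^+ 2 :> R by rewrite -exprM mulnC exprM; congr (_ ^+ _); ring.
  have sn : s != 0 by rewrite gt_eqF.
  have mn : 2 ^+ m != 0 :> R by rewrite expf_neq0 ?pnatr_eq0.
  by rewrite /h; field; rewrite sn mn.
by rewrite leNgt => /negP.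
Qed.

End Goursat.

(** * The maximum principle on a square and the Schwarz lemma *)

Lemma differentiable_pow (K : numFieldType) (V : normedModType K) (f : V -> K) n x :
  differentiable f x -> differentiable (fun z => f z ^+ n) x.
Proof.
case: n => [|n] df; first exact: differentiable_cst.
by rewrite -exprfctE; exact: differentiableX.
Qed.

Section MaximumPrinciple.
Context {R : realType}.
Local Notation C := (Cplx R).
Local Notation Re := (@complex.Re R).
Local Notation Im := (@complex.Im R).
Implicit Types (F G : C -> C) (c v z w p : C) (s : R).
Local Notation contour := (contour (@imag R)).

Lemma Re_inv z : Re z^-1 = Re z / (Re z ^+ 2 + Im z ^+ 2).
Proof. by case: z. Qed.

Lemma Im_inv z : Im z^-1 = - Im z / (Re z ^+ 2 + Im z ^+ 2).
Proof. by case: z => a b /=; rewrite mulNr. Qed.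

Lemma derivable_cdiff F p : derivable F p 1 -> cdiff F p.
Proof.
move=> /cvg_ex [a /= ha]; exists a => e e0.
have : nbhs a [set y : C | cabs (y - a) < e] by apply/nbhs_cabsP; exists e.
move=> /ha; rewrite /= => /nbhs_cabsP [r r0 hr]; exists r => // z zp.
have [->|zNp] := eqVneq z p; first by rewrite !subrr mulr0 subrr cabs0 mulr0.
have zp0 : z - p != 0 by rewrite subr_eq0.
have := hr (z - p); rewrite subr0 => /(_ zp zp0) /=.
rewrite [_ *: 1]mulr1 subrK => h.
have -> : F z - F p - a * (z - p) = ((z - p)^-1 *: (F z - F p) - a) * (z - p).
  by rewrite mulrBl [_ *: _]mulrC mulfVK.
by rewrite cabsM ler_wpM2r ?cabs_ge0 // ltW.
Qed.

(** Where a differentiable [u] vanishes, dividing a power of [u] by one power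
    less of [z - w] leaves a differentiable function: at [w] the difference
    quotient of the result is a power of the one of [u]. Dividing [u] itself by
    [z - w] would require to know that [u] has a second derivative. *)
Lemma derivable_power_quotient (u : C -> C) w n p : u w = 0 ->
  derivable u p 1 -> derivable (fun z => u z ^+ n.+1 / (z - w) ^+ n) p 1.
Proof.
move=> uw; have [->|pw] := eqVneq p w; last first.
  move=> /derivable1_diffP du; apply/derivable1_diffP.
  apply: differentiableM; first exact: differentiable_pow.
  apply: differentiableV; last by rewrite expf_neq0 // subr_eq0.
  by apply: differentiable_pow; apply: differentiableB => //; exact: differentiable_cst.
move=> du; rewrite /derivable.
have -> : (fun h : C => h^-1 *: (((fun z => u z ^+ n.+1 / (z - w) ^+ n) \o shift w) (h *: 1)
    - u w ^+ n.+1 / (w - w) ^+ n)) =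
    (fun h : C => (h^-1 *: ((u \o shift w) (h *: 1) - u w)) ^+ n.+1).
  apply/funext => h /=; rewrite [h *: 1]mulr1 addrK uw subr0 expr0n /= mul0r subr0.
  by rewrite exprMn [(h^-1) ^+ _]exprS -!exprVn -mulrA; congr (_ * _); rewrite mulrC.
move: du => /cvg_ex [a ha]; apply/cvg_ex; exists (a ^+ n.+1).
have dX : differentiable (fun z : C => z ^+ n.+1) a by apply: differentiable_pow.
by move=> A /(differentiable_continuous dX) /ha.
Qed.

(** Each side contributes an increment of the argument of [z - w], which is
    bounded below uniformly in the subdivision. *)
Lemma contour_inv_ge N c s w d : 0 < d ->
  Re c + d <= Re w <= Re c + s - d -> Im c + d <= Im w <= Im c + s - d ->
  d / (2 * s) <= cabs (contour N (fun z => (z - w)^-1) c (ofR s)).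
Proof.
move=> d0 /andP[w1 w2] /andP[w3 w4].
have s0 : 0 < s by lra.
have k0 : 0 < d / (2 * s) by rewrite divr_gt0 // mulr_gt0.
have den (a b : R) : `|a| <= s -> `|b| <= s -> d <= a ->
    d / (2 * s) <= s * (a / (a ^+ 2 + b ^+ 2)).
  rewrite !ler_norml => /andP[a1 a2] /andP[b1 b2] da.
  have q0 : 0 < a ^+ 2 + b ^+ 2 by nra.
  rewrite mulrA ler_pdivlMr // mulrAC ler_pdivrMr ?mulr_gt0 //.
  have : a ^+ 2 + b ^+ 2 <= 2 * s ^+ 2 by nra.
  have : 0 <= s * s by nra.
  nra.
have up z : `|Re z| <= s -> `|Im z| <= s -> d <= - Im z ->
    d / (2 * s) <= Im (z^-1 * ofR s).
  rewrite [z^-1 * _]mulrC cImMr Im_inv addrC -(sqrrN (Im z)) -(normrN (Im z)).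
  by move=> *; exact: den.
have right z : `|Re z| <= s -> `|Im z| <= s -> d <= Re z ->
    d / (2 * s) <= Im (z^-1 * (imag * ofR s)).
  by rewrite mulrCA cImMi [z^-1 * _]mulrC cReMr Re_inv => *; exact: den.
have down z : `|Re z| <= s -> `|Im z| <= s -> d <= Im z ->
    d / (2 * s) <= Im (- z^-1 * ofR s).
  by rewrite [- z^-1 * _]mulrC cImMr cImN Im_inv mulNr opprK addrC => *; exact: den.
have left z : `|Re z| <= s -> `|Im z| <= s -> d <= - Re z ->
    d / (2 * s) <= Im (- z^-1 * (imag * ofR s)).
  rewrite mulrCA cImMi [- z^-1 * _]mulrC cReMr cReN Re_inv -mulNr -(sqrrN (Re z)) -(normrN (Re z)).
  by move=> *; exact: den.
have e1 : d / (2 * s) <= Im (edge N (fun z => (z - w)^-1) c (ofR s)).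
  apply: edge_Im_ge => t /andP[t0 t1]; apply: up; rewrite !ReIm ?ler_norml; try (apply/andP; split); nra.
have e2 : d / (2 * s) <= Im (edge N (fun z => (z - w)^-1) (c + ofR s) (imag * ofR s)).
  apply: edge_Im_ge => t /andP[t0 t1]; apply: right; rewrite !ReIm ?ler_norml; try (apply/andP; split); nra.
have e3 : d / (2 * s) <= Im (- edge N (fun z => (z - w)^-1) (c + imag * ofR s) (ofR s)).
  rewrite -edge_opp.
  apply: edge_Im_ge => t /andP[t0 t1]; apply: down; rewrite !ReIm ?ler_norml; try (apply/andP; split); nra.
have e4 : d / (2 * s) <= Im (- edge N (fun z => (z - w)^-1) c (imag * ofR s)).
  rewrite -edge_opp.
  apply: edge_Im_ge => t /andP[t0 t1]; apply: left; rewrite !ReIm ?ler_norml; try (apply/andP; split); nra.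
apply: le_trans (cabs_ge_Im _); apply: le_trans (ler_norm _).
by rewrite /contour !cImD; lra.
Qed.

Lemma small_power (x e : R) : 0 <= x < 1 -> 0 < e -> exists K, x ^+ K <= e.
Proof.
move=> /andP[x0 x1] e0.
have /cvg_expr/cvgrPdist_lt/(_ _ e0) [K _ h] : `|x| < 1 by rewrite ger0_norm.
exists K; have := h K (leqnn K); rewrite /= sub0r normrN => /ltW; apply: le_trans.
exact: ler_norm.
Qed.

(** If [F] were larger at [w] than on the boundary, some power [f] of
    [F / F w] would be tiny there, so that [(f - 1) ^ 2 / (z - w)], which is
    differentiable in the whole square, would be close to [1 / (z - w)] on the
    boundary. The contour sums of the former tend to zero, the ones of the latter
    do not. *)
Lemma square_max_principle F c s w d m : 0 < d ->
  Re c + d <= Re w <= Re c + s - d -> Im c + d <= Im w <= Im c + s - d ->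
  (forall z, square c s z -> derivable F z 1) ->
  (forall z, square_boundary c s z -> cabs (F z) <= m) ->
  cabs (F w) <= m.
Proof.
move=> d0 w1 w2 dF bF; rewrite leNgt; apply/negP => mF.
have s0 : 0 < s by case/andP: w1; lra.
have cb : square_boundary c s c.
  split; last by constructor 1.
  by apply/andP; split; apply/andP; split; lra.
have m0 : 0 <= m by apply: le_trans (bF _ cb); exact: cabs_ge0.
have Fw : F w != 0 by rewrite -cabs_gt0 (le_lt_trans m0).
pose k := d / (2 * s).
have k0 : 0 < k by rewrite divr_gt0 // mulr_gt0.
pose e := Num.min 1 (k * d / (48 * s)).
have e0 : 0 < e by rewrite lt_min ltr01 /= divr_gt0 // mulr_gt0.
have [|K hK] := @small_power (m / cabs (F w)) e _ e0.
  by rewrite divr_ge0 ?cabs_ge0 //= ltr_pdivrMr ?cabs_gt0 // mul1r.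
pose f z := (F z / F w) ^+ K.
pose g z := (f z - 1) ^+ 2 / (z - w) ^+ 1.
have fw : f w - 1 = 0 by rewrite /f divff // expr1n subrr.
have dg z : square c s z -> cdiff g z.
  move=> /dF /derivable1_diffP dFz; apply: derivable_cdiff.
  apply: (@derivable_power_quotient (fun y => f y - 1) w 1 z fw); apply/derivable1_diffP.
  apply: differentiableB; last exact: differentiable_cst.
  apply: differentiable_pow; apply: differentiableM => //; exact: differentiable_cst.
have := goursat s0 (divr_gt0 k0 (ltr0n _ 2)) dg; apply => N0; exists N0 => //.
have -> : contour N0 g c (ofR s) =
   contour N0 (fun z => (z - w)^-1 + (f z ^+ 2 - 2 * f z) / (z - w)) c (ofR s).
  by congr contour; apply/funext => z; rewrite /g; ring.
rewrite contour_add.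
have bnd z : square_boundary c s z -> cabs ((f z ^+ 2 - 2 * f z) / (z - w)) <= 3 * e / d.
  move=> bz; have fz : cabs (f z) <= e.
    rewrite /f cabsX cabsM cabsV; apply: le_trans hK; apply: lerXn2r.
    - by rewrite nnegrE divr_ge0 ?cabs_ge0.
    - by rewrite nnegrE divr_ge0 ?cabs_ge0.
    - by rewrite ler_wpM2r ?invr_ge0 ?cabs_ge0 ?bF.
  have zw : d <= cabs (z - w).
    case: bz => _; have := cabs_ge_Re (z - w); have := cabs_ge_Im (z - w).
    rewrite !ReIm !ler_norml => /andP[h1 h2] /andP[h3 h4].
    by case/andP: w1 => l1 l2; case/andP: w2 => l3 l4; case; lra.
  rewrite cabsM cabsV; apply: ler_pM; rewrite ?invr_ge0 ?cabs_ge0 //; last first.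
    by rewrite lef_pV2 ?posrE // (lt_le_trans d0 zw).
  apply: le_trans (cabsD _ _) _; rewrite cabsN cabsM cabsX -(rmorph_nat (@ofR R)) cabs_real //.
  have : e <= 1 by rewrite ge_min lexx.
  by have := cabs_ge0 (f z); nra.
have := contour_le N0 (ltW s0) bnd; have := contour_inv_ge N0 d0 w1 w2.
move: (contour _ _ _ _) (contour _ _ _ _) => b a ha hb.
have : 4 * (3 * e / d) * s <= k / 4.
  have : e <= k * d / (48 * s) by rewrite ge_min lexx orbT.
  rewrite ler_pdivlMr ?mulr_gt0 // => he.
  have -> : 4 * (3 * e / d) * s = (e * (48 * s)) / (4 * d).
    by field; rewrite gt_eqF.
  rewrite ler_pdivrMr ?mulr_gt0 //; apply: le_trans he _.
  by rewrite le_eqVlt; apply/orP; left; apply/eqP; field.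
have := cabsD (a + b) (- b); rewrite addrK cabsN -/k in ha *; lra.
Qed.

(** The maximum principle for [u ^ (n + 1) / (z - p) ^ n] gives
    [|u| ^ (n + 1) <= M * (M * |z - p| / s) ^ n]; let [n] tend to infinity. *)
Lemma schwarz (u : C -> C) p s M w : 0 < s -> u p = 0 -> cabs (w - p) < s ->
  (forall z, `|Re z - Re p| <= s -> `|Im z - Im p| <= s ->
     derivable u z 1 /\ cabs (u z) <= M) ->
  cabs (u w) <= M / s * cabs (w - p).
Proof.
move=> s0 up ws hu.
have M0 : 0 <= M by have [|//|_] := hu p; rewrite ?subrr ?normr0 ?(ltW s0) ?up ?cabs0.
have [->|wp] := eqVneq w p; first by rewrite up subrr cabs0 mulr0.
have r0 : 0 < cabs (w - p) by rewrite cabs_gt0 subr_eq0.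
set x := cabs (u w); set y := M / s * cabs (w - p).
have y0 : 0 <= y by rewrite mulr_ge0 ?cabs_ge0 // divr_ge0 // ltW.
have key n : x ^+ n.+1 <= M * y ^+ n.
  pose c := p - ofR s - imag * ofR s.
  have hc1 : Re c = Re p - s by rewrite /c !ReIm oppr0 oppr0 addr0.
  have hc2 : Im c = Im p - s by rewrite /c !ReIm oppr0 addr0.
  have := cabs_ge_Re (w - p); have := cabs_ge_Im (w - p).
  rewrite !ReIm !ler_norml => /andP[i1 i2] /andP[i3 i4].
  have := @square_max_principle (fun z => u z ^+ n.+1 / (z - p) ^+ n) c (2 * s) w
    (s - cabs (w - p)) (M ^+ n.+1 / s ^+ n).
  rewrite hc1 hc2 subr_gt0 => smp.
  suff : cabs (u w ^+ n.+1 / (w - p) ^+ n) <= M ^+ n.+1 / s ^+ n.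
    rewrite cabsM cabsV !cabsX ler_pdivrMr ?exprn_gt0 // => /le_trans; apply.
    by rewrite le_eqVlt; apply/orP; left; apply/eqP; rewrite /y !exprMn exprVn exprS; ring.
  apply: smp => //.
  - by apply/andP; split; lra.
  - by apply/andP; split; lra.
  - move=> z /andP[/andP[z1 z2] /andP[z3 z4]]; rewrite hc1 hc2 in z1 z2 z3 z4.
    apply: derivable_power_quotient up _.
    by have [] := hu z; rewrite ?ler_norml //; apply/andP; split; lra.
  - move=> z [/andP[/andP[z1 z2] /andP[z3 z4]] zb]; rewrite hc1 hc2 in z1 z2 z3 z4 zb.
    have uz : cabs (u z) <= M.
      by have [] := hu z; rewrite ?ler_norml //; apply/andP; split; lra.
    have zp : s <= cabs (z - p).
      have := cabs_ge_Re (z - p); have := cabs_ge_Im (z - p).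
      rewrite !ReIm !ler_norml => /andP[j1 j2] /andP[j3 j4].
      by case: zb; lra.
    rewrite cabsM cabsV !cabsX; apply: ler_pM; rewrite ?invr_ge0 ?exprn_ge0 ?cabs_ge0 //.
      by rewrite lerXn2r // nnegrE cabs_ge0.
    rewrite lef_pV2 ?posrE ?exprn_gt0 ?(lt_le_trans s0 zp) //.
    by rewrite lerXn2r // nnegrE ltW // (lt_le_trans s0 zp).
rewrite leNgt; apply/negP => yx.
have x0 : 0 < x by apply: le_lt_trans yx.
have e0 : 0 < x / (M + 1) / 2 by rewrite divr_gt0 // divr_gt0 //; lra.
have [|n hn] := @small_power (y / x) _ _ e0.
  by rewrite divr_ge0 ?(ltW x0) //= ltr_pdivrMr // mul1r.
have := key n; rewrite leNgt => /negP; apply.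
rewrite -[y](@mulfVK _ x) ?gt_eqF // exprMn mulrA exprS ltr_pM2r ?exprn_gt0 //.
have M1 : 0 < M + 1 by lra.
apply: le_lt_trans (_ : M * (x / (M + 1) / 2) < x); first by rewrite ler_wpM2l.
have -> : M * (x / (M + 1) / 2) = M * x / ((M + 1) * 2) by field; rewrite gt_eqF.
by rewrite ltr_pdivrMr ?mulr_gt0 //; nra.
Qed.

End MaximumPrinciple.

(** * The Gelfand-Mazur theorem *)

Section GelfandMazur.
Context {R : realType}.
Local Notation C := (Cplx R).
Variables (K : fieldType) (e : {rmorphism C -> K}) (q : K -> R).
Hypothesis q_ge0 : forall a, 0 <= q a.
Hypothesis q1 : q 1 = 1.
Hypothesis qD : forall a b, q (a + b) <= q a + q b.
Hypothesis qM : forall a b, q (a * b) <= q a * q b.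
Hypothesis qe : forall c, q (e c) <= cabs c.

Lemma qX a n : q (a ^+ n) <= q a ^+ n.
Proof.
elim: n => [|n IH]; first by rewrite !expr0 q1.
by rewrite !exprS (le_trans (qM _ _)) // ler_wpM2l.
Qed.

Lemma qZ c a : q (e c * a) <= cabs c * q a.
Proof. by rewrite (le_trans (qM _ _)) // ler_wpM2r. Qed.

Lemma qN a : q (- a) <= q a.
Proof. by have := qZ (-1) a; rewrite rmorphN rmorph1 mulN1r cabsN cabs1 mul1r. Qed.

(** The geometric series is replaced by the identity [b = 1 + a * b] for the
    inverse [b] of [1 - a], which makes completeness unnecessary. *)
Lemma q_neumann a (t : R) : q a <= t -> t < 1 ->
  1 - a != 0 /\ q (1 - a)^-1 <= (1 - t)^-1.
Proof.
move=> qa t1; have a1 : 1 - a != 0.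
  by apply/eqP => /eqP; rewrite subr_eq0 => /eqP a1; move: qa; rewrite -a1 q1; lra.
split=> //; rewrite -[leRHS]mul1r ler_pdivlMr; last by lra.
have := qD 1 (a * (1 - a)^-1); rewrite q1.
have -> : 1 + a * (1 - a)^-1 = (1 - a)^-1 by field.
by have := qM a (1 - a)^-1; have := q_ge0 (1 - a)^-1; nra.
Qed.

Section NoEigenvalue.
Variable x : K.
Hypothesis xC : forall l, x != e l.

Let w := x^-1.
Let U (l : C) : K := (1 - e l * w)^-1.
Let T k (l : C) : K := (1 - (e l * w) ^+ (2 ^ k))^-1.

Let x0 : x != 0. Proof. by have := xC 0; rewrite rmorph0. Qed.

Let U0 l : 1 - e l * w != 0.
Proof.
have -> : 1 - e l * w = (x - e l) * w by rewrite mulrBl mulfV.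
by rewrite mulf_neq0 ?invr_eq0 // subr_eq0.
Qed.

Let U_bounded (r : R) :
  exists2 B, 0 < B & forall l, cabs l <= r -> q (U l) <= B.
Proof.
have := @compact_closed_disc R r => /compact_near_coveringP/near_covering_withinP.
move=> /(_ R +oo%R (fun B l => q (U l) <= B) _)[l0 _|M [_ h]].
  pose t := q (w * U l0) + 1.
  have t0 : 0 < t by rewrite ltr_wpDl.
  exists ([set l : C | cabs (l - l0) < (2 * t)^-1], [set M : R | q (U l0) * 2 < M]).
    split; first by apply/nbhs_cabsP; exists (2 * t)^-1; rewrite ?invr_gt0 ?mulr_gt0.
    by exists (q (U l0) * 2); split => //; apply: num_real.
  move=> [l M] [/= hl hM] _; apply: le_trans (ltW hM).
  have [|//|_ nU] := @q_neumann (e (l - l0) * (w * U l0)) 2^-1; last first.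
  - have -> : U l = U l0 * (1 - e (l - l0) * (w * U l0))^-1.
      rewrite /U -invfM; congr (_^-1); rewrite mulrBr mulr1.
      have := U0 l0; rewrite rmorphB /= => n0; by field.
    apply: le_trans (qM _ _) _; rewrite ler_wpM2l //; apply: le_trans nU _.
    by rewrite le_eqVlt; apply/orP; left; apply/eqP; field.
  - by rewrite invf_lt1 // ltr1n.
  apply: le_trans (qZ _ _) _.
  have qt : q (w * U l0) <= t by rewrite ler_wpDr.
  apply: le_trans (ler_pM _ _ (ltW hl) qt) _; rewrite ?cabs_ge0 //.
  by rewrite invfM mulfVK // gt_eqF.
exists (Num.max M 0 + 1); first by rewrite ltr_wpDl // le_max lexx orbT.
move=> l lr; apply: h => //=; rewrite (@le_lt_trans _ _ (Num.max M 0)) ?ltrDl //.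
by rewrite le_max lexx.
Qed.

(** [1 / (1 - y ^ 2)] is the mean of [1 / (1 - y)] and [1 / (1 + y)], and the
    second one is a rotation of the first: hence [T k] inherits the Lipschitz
    constant of [T 0], whatever [k]. *)
Let T_lipschitz (r L : R) :
  (forall l m, cabs l <= r -> cabs m <= r -> q (U l - U m) <= L * cabs (l - m)) ->
  forall k, (forall l, 1 - (e l * w) ^+ (2 ^ k) != 0) /\
    forall l m, cabs l <= r -> cabs m <= r -> q (T k l - T k m) <= L * cabs (l - m).
Proof.
move=> UL; elim=> [|k [nz IH]]; first by split=> l; rewrite /T expn0 expr1 //; exact: UL.
pose z : C := (2 ^ k).-root (-1).
have zk : z ^+ (2 ^ k) = -1 by rewrite rootCK // expn_gt0.
have z1 : cabs z = 1.
  have : cabs z ^+ (2 ^ k) = 1 by rewrite -cabsX zk cabsN cabs1.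
  by move/eqP; rewrite pexpr_eq1 ?cabs_ge0 ?expn_gt0 // => /eqP.
have rot l : (e (z * l) * w) ^+ (2 ^ k) = - (e l * w) ^+ (2 ^ k).
  by rewrite rmorphM -mulrA exprMn -rmorphXn zk rmorphN rmorph1 mulN1r.
have sq l : (e l * w) ^+ (2 ^ k.+1) = ((e l * w) ^+ (2 ^ k)) ^+ 2.
  by rewrite expnSr exprM.
have nz2 : (2 : K) != 0 by rewrite -(rmorph_nat e) fmorph_eq0 pnatr_eq0.
have TS l : T k.+1 l = e 2^-1 * (T k l + T k (z * l)).
  have := nz l; have := nz (z * l); rewrite /T rot sq fmorphV rmorph_nat.
  move: (_ ^+ (2 ^ k)) => Y; rewrite opprK => Y1 Y2.
  have Y3 : 1 - Y ^+ 2 != 0 by rewrite -[1](expr1n K 2) subr_sqr mulf_neq0.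
  by field; rewrite nz2 Y1 Y2 Y3.
split=> [l|l m lr mr].
  have := nz l; have := nz (z * l); rewrite rot sq opprK => n1 n2.
  by rewrite -[1](expr1n K 2) subr_sqr mulf_neq0.
have -> : T k.+1 l - T k.+1 m = e 2^-1 * ((T k l - T k m) + (T k (z * l) - T k (z * m))).
  by rewrite !TS; ring.
have h1 := IH _ _ lr mr; have h2 : q (T k (z * l) - T k (z * m)) <= L * cabs (l - m).
  have -> : cabs (l - m) = cabs (z * l - z * m) by rewrite -mulrBr cabsM z1 mul1r.
  by apply: IH; rewrite cabsM z1 mul1r.
apply: le_trans (qZ _ _) _; rewrite cabsV -(rmorph_nat (@ofR R)) cabs_real ?ler0n //.
have := qD (T k l - T k m) (T k (z * l) - T k (z * m)); lra.
Qed.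

Let good (r : R) := exists k, r ^+ (2 ^ k) * q (w ^+ (2 ^ k)) < 1.

(** If [good r], the powers of [r / x] tend to zero along the exponents [2 ^ k],
    and [T k r] is close to [1] for some large [k]; so is [T k s] for [s] close
    to [r] by the uniform Lipschitz bound, and then [(s / x) ^ (2 ^ k)] has norm
    below [1]. The step does not depend on [r]. *)
Let good_step (b L r : R) : 0 < L ->
  (forall l m, cabs l <= b -> cabs m <= b -> q (U l - U m) <= L * cabs (l - m)) ->
  0 <= r -> r + (8 * L)^-1 <= b -> good r -> good (r + (8 * L)^-1).
Proof.
move=> L0 UL r0 rb [k hk]; set s := r + _.
have h0 : 0 < (8 * L)^-1 by rewrite invr_gt0 mulr_gt0.
have s0 : 0 < s by rewrite /s; lra.
set th := r ^+ (2 ^ k) * q (w ^+ (2 ^ k)) in hk.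
have th0 : 0 <= th by rewrite mulr_ge0 ?exprn_ge0.
have [j hj] : exists j, th ^+ j <= 1 / 8.
  by apply: small_power; [rewrite th0 hk|lra].
pose N := (k + j)%N; exists N.
have {}hj : r ^+ (2 ^ N) * q (w ^+ (2 ^ N)) <= 1 / 8.
  apply: le_trans hj; apply: (@le_trans _ _ (th ^+ (2 ^ j))); last first.
    by apply: ler_wiXn2l; rewrite ?(ltW hk) // ltnW // ltn_expl.
  rewrite /N expnD !exprM exprMn; apply: ler_wpM2l; first by rewrite !exprn_ge0.
  exact: qX.
have [nz TL] := T_lipschitz UL N.
pose Y t := (e (ofR t) * w) ^+ (2 ^ N).
have Yr : q (Y r) <= 1 / 8.
  apply: le_trans hj; rewrite /Y exprMn -rmorphXn; apply: le_trans (qZ _ _) _.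
  by rewrite cabsX cabs_real.
have [|_ qTr] := q_neumann Yr; first by lra.
have Tr1 : q (T N (ofR r) - 1) <= 1 / 7.
  have -> : T N (ofR r) - 1 = Y r * T N (ofR r).
    by have := nz (ofR r); rewrite /T /Y => n0; field.
  apply: le_trans (qM _ _) _; apply: le_trans (ler_pM _ _ Yr qTr) _ => //.
  by rewrite le_eqVlt; apply/orP; left; apply/eqP; field.
have Ts1 : q (T N (ofR s) - 1) <= 1 / 3.
  have : q (T N (ofR s) - T N (ofR r)) <= 1 / 8.
    apply: le_trans (TL _ _ _ _) _; rewrite ?cabs_real //; try (rewrite /s; lra).
    rewrite -rmorphB cabs_real /s addrAC subrr add0r ?(ltW h0) //.
    by rewrite le_eqVlt; apply/orP; left; apply/eqP; field; rewrite gt_eqF.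
  have := qD (T N (ofR s) - T N (ofR r)) (T N (ofR r) - 1).
  by rewrite addrA subrK; lra.
have Ys : q (Y s) <= 1 / 2.
  have [|_ qs] := @q_neumann (- (T N (ofR s) - 1)) (1 / 3) (le_trans (qN _) Ts1); first by lra.
  have -> : Y s = (T N (ofR s) - 1) * (1 - - (T N (ofR s) - 1))^-1.
    rewrite opprK addrCA subrr addr0 /T /Y invrK.
    by have := nz (ofR s) => n0; field.
  apply: le_trans (qM _ _) _; apply: le_trans (ler_pM _ _ Ts1 qs) _ => //.
  by rewrite le_eqVlt; apply/orP; left; apply/eqP; field.
apply: (@le_lt_trans _ _ (1 / 2)); last by lra.
apply: le_trans Ys; rewrite mulrC -ler_pdivlMr ?exprn_gt0 // mulrC.
have -> : w ^+ (2 ^ N) = e (ofR ((s ^+ (2 ^ N))^-1)) * Y s.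
  rewrite /Y exprMn -!rmorphXn mulrA -rmorphM -rmorphM mulVf ?rmorph1 ?mul1r //.
  by rewrite expf_neq0 // gt_eqF.
by apply: le_trans (qZ _ _) _; rewrite cabs_real // invr_ge0 exprn_ge0 // ltW.
Qed.

(** By [good_step] all [r] up to [q x + 1] would be good; but [r] is not good
    when [q x <= r], because [1 = q (x ^ n / x ^ n) <= r ^ n * q (1 / x ^ n)]. *)
Lemma no_eigenvalue_false : False.
Proof.
pose b := q x + 1.
have [B B0 hB] := U_bounded b.
pose L := q w * B ^+ 2 + 1.
have L1 : 1 <= L by rewrite lerDr mulr_ge0 ?exprn_ge0 // ltW.
have UL l m : cabs l <= b -> cabs m <= b -> q (U l - U m) <= L * cabs (l - m).
  move=> lb mb.
  have -> : U l - U m = e (l - m) * (w * (U l * U m)).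
    by have := U0 l; have := U0 m; rewrite /U rmorphB => n1 n2; field; rewrite n1 n2.
  apply: le_trans (qZ _ _) _; rewrite mulrC ler_wpM2r ?cabs_ge0 //.
  apply: le_trans (qM _ _) _; apply: (@le_trans _ _ (q w * B ^+ 2)); last by rewrite lerDl.
  rewrite ler_wpM2l // expr2; apply: le_trans (qM _ _) _.
  by apply: ler_pM => //; exact: hB.
pose h := (8 * L)^-1.
have h0 : 0 < h by rewrite invr_gt0; lra.
have h1 : h <= 1 by rewrite invf_le1; lra.
have good_all m : m%:R * h <= b -> good (m%:R * h).
  elim: m => [|m IH]; first by exists 0%N; rewrite mul0r expr0n mul0r.
  rewrite -natr1 mulrDl mul1r => mb; apply: (@good_step b L) => //; first by lra.
    by rewrite mulr_ge0 ?ler0n ?ltW.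
  by apply: IH; lra.
pose m := (Num.truncn (q x / h)).+1.
have /andP[m1 m2] := truncn_itv (divr_ge0 (q_ge0 x) (ltW h0)).
rewrite -/m ltr_pdivrMr // in m2; rewrite ler_pdivlMr // in m1.
have [|k] := good_all m; first by rewrite /m -natr1 mulrDl mul1r /b; lra.
apply/negP; rewrite -leNgt; apply: (@le_trans _ _ (q (x ^+ (2 ^ k) * w ^+ (2 ^ k)))).
  by rewrite -exprMn mulfV // expr1n q1.
apply: le_trans (qM _ _) _; rewrite ler_wpM2r //; apply: le_trans (qX _ _) _.
have mh0 : 0 <= m%:R * h := le_trans (q_ge0 x) (ltW m2).
by apply: lerXn2r; rewrite ?nnegrE //; exact: ltW.
Qed.

End NoEigenvalue.

Theorem gelfand_mazur x : exists l, x = e l.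
Proof.
apply: contrapT => nx; apply: (@no_eigenvalue_false x) => l.
by apply/eqP => xl; apply: nx; exists l.
Qed.

End GelfandMazur.

(** * Maximal ideals and characters of a normed algebra *)

Section MaximalIdeal.
Variable A : comNzRingType.
Implicit Types (I J M : set A) (a b : A).

Definition proper_ideal_set I :=
  [/\ I 0, ~ I 1 & forall a b c, I b -> I c -> I (a * b + c)].

(** Maximality is recorded in the form in which it is used: the quotient is a
    field. *)
Definition maximal_ideal M := proper_ideal_set M /\
  forall a, ~ M a -> exists b, M (1 - a * b).

Lemma maximal_ideal_exists I : proper_ideal_set I ->
  exists2 M, maximal_ideal M & I `<=` M.
Proof.
move=> pI.
(* The empty set is added so that the empty chain has an upper bound. *)
pose P : set (set A) := [set J | J = set0 \/ (proper_ideal_set J /\ I `<=` J)].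
have [F FP tF|M [PM maxM]] := @Zorn_bigcup A P.
  have [[J FJ [x Jx]]|nF] := pselect (exists2 J, F J & J !=set0); last first.
    left; rewrite -subset0 => x [J FJ Jx]; apply: nF; exists J => //; by exists x.
  have inF K y : F K -> K y -> proper_ideal_set K /\ I `<=` K.
    by move=> FK Ky; have [K0|//] := FP K FK; rewrite K0 in Ky.
  right; have [[J0 J1 Jc] IJ] := inF _ _ FJ Jx; split; last first.
    by move=> y Iy; exists J => //; exact: IJ.
  split; first by exists J.
    by move=> [K FK K1]; have [[_ nK1 _] _] := inF _ _ FK K1; exact: nK1.
  move=> a b c [K FK Kb] [L FL Lc].
  have [[_ _ hK] _] := inF _ _ FK Kb; have [[_ _ hL] _] := inF _ _ FL Lc.
  have [KL|LK] := tF _ _ FK FL.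
    by exists L => //; apply: hL => //; exact: KL.
  by exists K => //; apply: hK => //; exact: LK.
have [pM IM] : proper_ideal_set M /\ I `<=` M.
  case: PM => // M0; exfalso; apply: (maxM I); last by right; split.
  rewrite M0; split; first exact: sub0set.
  by move=> /(_ 0 _) h; apply: h; case: pI.
exists M => //; split=> // a nMa; apply: contrapT => nb.
pose J : set A := [set x | exists b, M (x - a * b)].
have JM : M `<=` J by move=> x Mx; exists 0; rewrite mulr0 subr0.
apply: (maxM J).
  split=> // JsM; apply: nMa; apply: JsM; exists 1; rewrite mulr1 subrr.
  by case: pM.
right; split; last by move=> x /IM /JM.
split; first by apply: JM; case: pM.
  by move=> [b h]; apply: nb; exists b.
move=> c x y [bx hx] [by_ hy]; exists (c * bx + by_).
have -> : c * x + y - a * (c * bx + by_) = c * (x - a * bx) + (y - a * by_) by ring.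
by case: pM => _ _; apply.
Qed.

Section Quotient.
Variable M : set A.
Hypothesis maxM : maximal_ideal M.

Definition ideal_pred : {pred A} := fun a => `[< M a >].

Lemma ideal_pred_closed : idealr_closed ideal_pred.
Proof.
have [[M0 M1 hM] _] := maxM; split; [exact/asboolP|by apply/negP => /asboolP|].
by move=> a x y /asboolP Mx /asboolP My; apply/asboolP; exact: hM.
Qed.

#[local] HB.instance Definition _ := isIdealr.Build A ideal_pred ideal_pred_closed.

Definition ideal_field := {ideal_quot ideal_pred}.
#[local] HB.instance Definition _ := GRing.ComNzRing.on ideal_field.

Definition ideal_proj : {rmorphism A -> ideal_field} := (\pi_{ideal_quot ideal_pred})%qT.

Lemma ideal_proj_eq0 a : ideal_proj a = 0 <-> M a.
Proof.
split=> [/eqP|Ma].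
  rewrite -(rmorph0 ideal_proj) /ideal_proj /= -Quotient.idealrBE subr0.
  by move/asboolP.
apply/eqP; rewrite -(rmorph0 ideal_proj) /ideal_proj /= -Quotient.idealrBE subr0.
exact/asboolP.
Qed.

Lemma ideal_proj_surj k : exists a, ideal_proj a = k.
Proof. by exists (generic_quotient.repr k); rewrite /ideal_proj /= generic_quotient.reprK. Qed.

Lemma ideal_field_inv_ex (k : ideal_field) :
  exists b : ideal_field, (k != 0 -> b * k = 1) /\ (k = 0 -> b = 0).
Proof.
have [->|k0] := eqVneq k 0; first by exists 0.
have [a ak] := ideal_proj_surj k.
have [|b Mb] := maxM.2 a.
  by move=> /ideal_proj_eq0; rewrite ak => k0'; rewrite k0' eqxx in k0.
exists (ideal_proj b); split=> [_|k0']; last by rewrite k0' eqxx in k0.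
move/ideal_proj_eq0: Mb; rewrite rmorphB rmorph1 rmorphM ak mulrC.
by move/eqP; rewrite subr_eq0 => /eqP.
Qed.

Definition ideal_field_inv k := projT1 (cid (ideal_field_inv_ex k)).

Lemma ideal_field_mulVf k : k != 0 -> ideal_field_inv k * k = 1.
Proof. exact: (projT2 (cid (ideal_field_inv_ex k))).1. Qed.

Lemma ideal_field_inv0 : ideal_field_inv 0 = 0.
Proof. exact: (projT2 (cid (ideal_field_inv_ex 0))).2. Qed.

#[local] HB.instance Definition _ :=
  GRing.ComNzRing_isField.Build ideal_field ideal_field_mulVf ideal_field_inv0.

Lemma maximal_ideal_quotient : exists (K : fieldType) (p : {rmorphism A -> K}),
  (forall a, p a = 0 <-> M a) /\ (forall k, exists a, p a = k).
Proof.
by exists ideal_field, ideal_proj; split; [exact: ideal_proj_eq0|exact: ideal_proj_surj].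
Qed.

End Quotient.
End MaximalIdeal.

(** [N] is only a seminorm, and invertibility is only required up to its kernel:
    this allows elements to be functions that matter on a subset of their domain. *)
Section Character.
Context {R : realType}.
Local Notation C := (Cplx R).
Variables (A : comNzRingType) (e : {rmorphism C -> A}) (N : A -> R).
Hypothesis N_ge0 : forall a, 0 <= N a.
Hypothesis ND : forall a b, N (a + b) <= N a + N b.
Hypothesis NM : forall a b, N (a * b) <= N a * N b.
Hypothesis Ne : forall c, N (e c) <= cabs c.
Hypothesis N_inv : forall a, N (1 - a) < 1 -> exists b, N (1 - a * b) = 0.

Section QuotientNorm.
Variables (K : fieldType) (p : {rmorphism A -> K}).
Hypothesis p_surj : forall k, exists a, p a = k.
Hypothesis pN0 : forall a, N a = 0 -> p a = 0.

Lemma proj_inv a : N (1 - a) < 1 -> p a != 0.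
Proof.
move=> /N_inv [b /pN0]; rewrite rmorphB rmorph1 rmorphM => /eqP.
by apply: contraTneq => ->; rewrite mul0r subr0 oner_eq0.
Qed.

Definition quotient_norm (k : K) : R := inf [set N a | a in [set a | p a = k]].

Let has_inf_fiber k : has_inf [set N a | a in [set a | p a = k]].
Proof.
split; first by have [a pa] := p_surj k; exists (N a); exists a.
by exists 0 => _ [a _ <-].
Qed.

Lemma quotient_norm_le a : quotient_norm (p a) <= N a.
Proof. by apply: ge_inf; [have [] := has_inf_fiber (p a)|exists a]. Qed.

Lemma quotient_norm_ge0 k : 0 <= quotient_norm k.
Proof. by apply: lb_le_inf; [have [] := has_inf_fiber k|move=> _ [a _ <-]]. Qed.

Lemma quotient_norm_lift k (t : R) : 0 < t ->
  exists2 a, p a = k & N a < quotient_norm k + t.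
Proof.
by move=> t0; have [_ [a pa <-] h] := inf_adherent t0 (has_inf_fiber k); exists a.
Qed.

Lemma quotient_normD k l : quotient_norm (k + l) <= quotient_norm k + quotient_norm l.
Proof.
apply/ler_addgt0Pr => t t0; have t2 : 0 < t / 2 by rewrite divr_gt0.
have [a <- ha] := quotient_norm_lift k t2; have [b <- hb] := quotient_norm_lift l t2.
by rewrite -rmorphD; have := quotient_norm_le (a + b); have := ND a b; lra.
Qed.

Lemma quotient_normM k l : quotient_norm (k * l) <= quotient_norm k * quotient_norm l.
Proof.
set x := quotient_norm k; set y := quotient_norm l.
have x0 : 0 <= x := quotient_norm_ge0 k; have y0 : 0 <= y := quotient_norm_ge0 l.
apply/ler_addgt0Pr => t t0.
pose s := Num.min 1 (t / (x + y + 1)).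
have s0 : 0 < s by rewrite lt_min ltr01 divr_gt0 //; lra.
have s1 : s <= 1 by rewrite ge_min lexx.
have st : s * (x + y + 1) <= t.
  by rewrite -ler_pdivlMr ?ge_min ?lexx ?orbT //; lra.
have [a pa ha] := quotient_norm_lift k s0; have [b pb hb] := quotient_norm_lift l s0.
have := quotient_norm_le (a * b); rewrite rmorphM pa pb => /le_trans; apply.
apply: le_trans (NM a b) _.
apply: (@le_trans _ _ ((x + s) * (y + s))); last by nra.
by apply: ler_pM => //; exact: ltW.
Qed.

(** A lift [a] of [1] with [N a < 1] would make [1 - a], which [p] kills,
    invertible up to the kernel of [N]. *)
Lemma quotient_norm1 : quotient_norm 1 = 1.
Proof.
apply/eqP; rewrite eq_le; apply/andP; split.
  by rewrite -(rmorph1 p) -(rmorph1 e); apply: le_trans (quotient_norm_le _) _;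
     apply: le_trans (Ne 1) _; rewrite cabs1.
apply: lb_le_inf; first by have [] := has_inf_fiber 1.
move=> _ [a pa <-]; rewrite leNgt; apply/negP => Na.
have /proj_inv : N (1 - (1 - a)) < 1 by rewrite opprB addrC subrK.
by rewrite rmorphB rmorph1 pa subrr eqxx.
Qed.

Lemma quotient_scalar k : exists l, k = p (e l).
Proof.
apply: (@gelfand_mazur R K (p \o e) quotient_norm).
- exact: quotient_norm_ge0.
- exact: quotient_norm1.
- exact: quotient_normD.
- exact: quotient_normM.
- by move=> c /=; apply: le_trans (quotient_norm_le _) (Ne c).
Qed.

End QuotientNorm.

(** The quotient by a maximal ideal containing [I] is the field of scalars by
    [quotient_scalar]. The bound holds for every character with [phi (e l) = l]
    that kills the kernel of [N], because [1 - a / l] is invertible up to that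
    kernel when [N a < |l|]. *)
Theorem character_exists (I : set A) : proper_ideal_set I ->
  (forall a, N a = 0 -> I a) ->
  exists phi : {rmorphism A -> C},
    [/\ forall c, phi (e c) = c, forall a, cabs (phi a) <= N a
      & forall a, I a -> phi a = 0].
Proof.
move=> /maximal_ideal_exists [M maxM IM] NI.
have [K [p [pM p_surj]]] := maximal_ideal_quotient maxM.
have pN0 a : N a = 0 -> p a = 0 by move=> /NI /IM /pM.
have scal a := cid (quotient_scalar p_surj pN0 (p a)).
pose phi a : C := projT1 (scal a).
have phiE a : p a = p (e (phi a)) by rewrite /phi; case: (scal a).
have inj : injective (p \o e) by exact: fmorph_inj.
have phi0 : phi 0 = 0 by apply: inj; rewrite /= -phiE !rmorph0.
have phiB : zmod_morphism phi.
  by move=> a b; apply: inj; rewrite /= -phiE !rmorphB /= -!phiE.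
have phiM : monoid_morphism phi.
  split=> [|a b]; apply: inj; rewrite /= -phiE ?rmorph1 //.
  by rewrite !rmorphM /= -!phiE.
pose m1 := GRing.isZmodMorphism.Build A C phi phiB.
pose m2 := GRing.isMonoidMorphism.Build A C phi phiM.
pose f : {rmorphism A -> C} := HB.pack phi m1 m2.
exists f; split=> [c|a|a Ia] /=.
- by apply: inj; rewrite /= -phiE.
- rewrite leNgt; apply/negP => aN.
  have l0 : phi a != 0 by rewrite -cabs_gt0 (le_lt_trans (N_ge0 a)).
  have /(proj_inv pN0) : N (1 - (1 - e (phi a)^-1 * a)) < 1.
    rewrite opprB addrC subrK; apply: le_lt_trans (NM _ _) _.
    apply: (@le_lt_trans _ _ ((cabs (phi a))^-1 * N a)).
      by rewrite ler_wpM2r // -cabsV Ne.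
    by rewrite mulrC ltr_pdivrMr ?mul1r // cabs_gt0.
  rewrite rmorphB rmorph1 rmorphM (phiE a) -(rmorphM p) -(rmorphM e).
  by rewrite mulVf // !rmorph1 subrr eqxx.
- by apply: inj; rewrite /= -phiE rmorph0 rmorph0; apply/pM/IM.
Qed.

End Character.

(** * The polydisc algebra as a normed ring *)

Section PolydiscRing.
Context {R : realType} {d : nat}.
Local Notation C := (Cplx R).
Implicit Types (f g : 'rV[C]_d -> C) (p z : 'rV[C]_d).

Lemma pd_cst (c : C) : polydisc_algebra (fun _ : 'rV[C]_d => c).
Proof.
split=> [z _|]; first exact: differentiable_cst.
by apply: continuous_subspaceT; exact: cst_continuous.
Qed.

Lemma pd_coord j : polydisc_algebra (fun z : 'rV[C]_d => z ord0 j).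
Proof.
split=> [z _|]; first exact: differentiable_coord.
by apply: continuous_subspaceT => z; exact: coord_continuous.
Qed.

Lemma pd_sub f g : polydisc_algebra f -> polydisc_algebra g ->
  polydisc_algebra (fun z => f z - g z).
Proof.
move=> [df cf] [dg cg]; split=> [z zD|].
  by apply: differentiableB; [exact: df|exact: dg].
move/subspace_continuousP : cf => cf; move/subspace_continuousP : cg => cg.
by apply/subspace_continuousP => z zD; apply: cvgB; [exact: cf|exact: cg].
Qed.

Lemma pd_mul f g : polydisc_algebra f -> polydisc_algebra g ->
  polydisc_algebra (fun z => f z * g z).
Proof.
move=> [df cf] [dg cg]; split=> [z zD|].
  by apply: differentiableM; [exact: df|exact: dg].
move/subspace_continuousP : cf => cf; move/subspace_continuousP : cg => cg.
by apply/subspace_continuousP => z zD; apply: cvgM; [exact: cf|exact: cg].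
Qed.

Lemma pd_inv f : polydisc_algebra f -> (forall z, closed_polydisc z -> f z != 0) ->
  polydisc_algebra (fun z => (f z)^-1).
Proof.
move=> [df cf] nz; split=> [z zD|].
  by apply: differentiableV; [exact: df|exact/nz/sub_closed_polydisc].
move/subspace_continuousP : cf => cf.
by apply/subspace_continuousP => z zD; apply: cvgV; [exact: nz|exact: cf].
Qed.

Definition pd_pred : {pred 'rV[C]_d -> C} := fun f => `[< polydisc_algebra f >].

Record pdalg := PDAlg { pdfun :> 'rV[C]_d -> C; _ : pdfun \in pd_pred }.

HB.instance Definition _ := [isSub for pdfun].
HB.instance Definition _ := [Choice of pdalg by <:].

Lemma pd_subring : subring_closed pd_pred.
Proof.
split=> [|f g /asboolP hf /asboolP hg|f g /asboolP hf /asboolP hg]; apply/asboolP.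
- exact: pd_cst.
- exact: pd_sub.
- exact: pd_mul.
Qed.

HB.instance Definition _ := GRing.isSubringClosed.Build _ pd_pred pd_subring.
HB.instance Definition _ := [SubChoice_isSubComNzRing of pdalg by <:].

Lemma pdP (f : pdalg) : polydisc_algebra f.
Proof. by case: f => f /= /asboolP. Qed.

Definition pd_of f (hf : polydisc_algebra f) : pdalg :=
  @PDAlg f (introT (asboolP _) hf).

Definition pd_scalar (c : C) : pdalg := pd_of (pd_cst c).

Lemma pd_scalar_zmod : zmod_morphism pd_scalar.
Proof. by move=> a b; apply: val_inj. Qed.

Lemma pd_scalar_monoid : monoid_morphism pd_scalar.
Proof. by split=> [|a b]; apply: val_inj. Qed.

HB.instance Definition _ := GRing.isZmodMorphism.Build C pdalg pd_scalar pd_scalar_zmod.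
HB.instance Definition _ := GRing.isMonoidMorphism.Build C pdalg pd_scalar pd_scalar_monoid.

(** A seminorm on total functions: it ignores the values off the closed
    polydisc. *)
Definition pdnorm (f : pdalg) : R := sup [set cabs (f z) | z in closed_polydisc].

Let zeroD : closed_polydisc (0 : 'rV[C]_d).
Proof. by apply/closed_polydiscE => j; rewrite mxE cabs0. Qed.

Lemma le_pdnorm (f : pdalg) z : closed_polydisc z -> cabs (f z) <= pdnorm f.
Proof.
move=> zD; apply: ub_le_sup; last by exists z.
have [M _ hM] := closed_polydisc_bounded (pdP f).2.
by exists M => _ [y yD <-]; exact: hM.
Qed.

Lemma pdnorm_le (f : pdalg) t :
  (forall z, closed_polydisc z -> cabs (f z) <= t) -> pdnorm f <= t.
Proof.
by move=> h; apply: ge_sup; [exists (cabs (f 0)); exists 0|move=> _ [z zD <-]; exact: h].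
Qed.

Lemma pdnorm_ge0 (f : pdalg) : 0 <= pdnorm f.
Proof. exact: le_trans (cabs_ge0 _) (le_pdnorm f zeroD). Qed.

Lemma pdnormD (f g : pdalg) : pdnorm (f + g) <= pdnorm f + pdnorm g.
Proof.
apply: pdnorm_le => z zD; apply: le_trans (cabsD _ _) _.
by apply: lerD; exact: le_pdnorm.
Qed.

Lemma pdnormM (f g : pdalg) : pdnorm (f * g) <= pdnorm f * pdnorm g.
Proof.
apply: pdnorm_le => z zD; rewrite cabsM.
by apply: ler_pM; rewrite ?cabs_ge0 //; exact: le_pdnorm.
Qed.

Lemma pdnorm_scalar c : pdnorm (pd_scalar c) <= cabs c.
Proof. by apply: pdnorm_le. Qed.

Lemma pdnorm_eq0 (f : pdalg) :
  pdnorm f = 0 <-> forall z, closed_polydisc z -> f z = 0.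
Proof.
split=> [f0 z zD|f0].
  apply/eqP; rewrite -cabs_eq0 eq_le cabs_ge0 andbT -f0; exact: le_pdnorm.
apply/eqP; rewrite eq_le pdnorm_ge0 andbT; apply: pdnorm_le => z zD.
by rewrite f0 // cabs0.
Qed.

Lemma pdnorm_inv (f : pdalg) : pdnorm (1 - f) < 1 -> exists g : pdalg, pdnorm (1 - f * g) = 0.
Proof.
move=> f1; have nz z : closed_polydisc z -> f z != 0.
  move=> zD; apply/eqP => fz; have := le_lt_trans (le_pdnorm (1 - f) zD) f1.
  have -> : (1 - f) z = 1 - f z by [].
  by rewrite fz subr0 cabs1 ltxx.
exists (pd_of (pd_inv (pdP f) nz)); apply/pdnorm_eq0 => z zD.
transitivity (1 - f z * (f z)^-1) => //; by rewrite mulfV ?nz // subrr.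
Qed.

End PolydiscRing.

(** * Characters of the polydisc algebra are evaluations *)

Section SquareQuotient.
Variables (K : numFieldType) (V : normedModType K).

(** [g] is constant along the kernel of [ell], so its differential factors
    through [ell]. *)
Lemma derivative_vanishing (ell : {linear V -> K}) (g : V -> K) p v0 :
  ell v0 = 1 -> (forall v, ell v = ell p -> g v = 0) -> differentiable g p ->
  forall h, 'd g p h = 'd g p v0 * ell h.
Proof.
move=> ev0 g0 dg.
have ker h : ell h = 0 -> 'd g p h = 0.
  move=> eh; rewrite -deriveE // /derive.
  have -> : (fun t : K => t^-1 *: ((g \o shift p) (t *: h) - g p)) = cst 0.
    apply/funext => t /=; rewrite !g0 ?subrr ?scaler0 //.
    by rewrite linearD linearZ /= eh scaler0 add0r.
  exact: lim_cst.
move=> h; have -> : h = (h - ell h *: v0) + ell h *: v0 by rewrite subrK.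
rewrite linearD ker ?add0r; last by rewrite linearB linearZ /= ev0 [_ *: 1]mulr1 subrr.
by rewrite linearZ /= subrK mulrC.
Qed.

(** Let [x = ell v - ell p], [a = 'd g p v0] and [r = g v - a * x], which is small
    compared with [v - p]. Then [g v ^ 2 / x - a ^ 2 * x = (a + g v / x) * r], and
    [g v / x] is bounded by [c]. *)
Lemma differentiable_square_quotient (ell : {linear V -> K}) (g : V -> K) p v0 c :
  continuous ell -> ell v0 = 1 -> (forall v, ell v = ell p -> g v = 0) ->
  differentiable g p -> 0 <= c ->
  (\forall v \near p, `|g v| <= c * `|ell v - ell p|) ->
  differentiable (fun v => g v ^+ 2 / (ell v - ell p)) p.
Proof.
move=> cl ev0 g0 dg c0 gc.
have da := derivative_vanishing ev0 g0 dg.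
set a := 'd g p v0 in da.
pose L : V -> K := fun h => (a ^+ 2) * ell h.
have linL : linear L by move=> k u v; rewrite /L linearP mulrDr mulrCA.
pose mL := GRing.isLinear.Build _ _ _ _ _ linL.
pose LL : {linear V -> K} := HB.pack L mL.
have cL : continuous LL by move=> v; apply: cvgM; [exact: cvg_cst|exact: cl].
set G := fun v => _.
have gp : g p = 0 by exact: g0.
have eG : G \o shift p = cst (G p) + LL +o_ (0 : V) id.
  apply/eqaddoP => eps eps0.
  have m0 : 0 < `|a| + c + 1 by rewrite ltr_wpDl // addr_ge0.
  have e0 : 0 < eps / (`|a| + c + 1) by rewrite divr_gt0.
  have /eqaddoP/(_ _ e0) H := diff_locally dg.
  have gc' : \forall h \near (0 : V), `|g (h + p)| <= c * `|ell h|.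
    have := gc; rewrite [X in X -> _](near_shift 0) /=; apply: filterS => h /=.
    by rewrite subr0 linearD addrK.
  have {}H : \forall h \near (0 : V),
      `|g (h + p) - (g p + 'd g p h)| <= eps / (`|a| + c + 1) * `|h| by exact: H.
  suff : \forall h \near (0 : V), `|G (h + p) - (G p + L h)| <= eps * `|h| by [].
  apply: filterS2 H gc' => h; have Gp : G p = 0 by rewrite /G gp expr0n mul0r.
  have eh : ell (h + p) - ell p = ell h by rewrite linearD addrK.
  rewrite Gp gp !add0r /G eh da /L; set u := g _; set x := ell h => hr hu.
  have [x0|x0] := eqVneq x 0.
    by rewrite x0 invr0 !mulr0 subr0 normr0 mulr_ge0 // ltW.
  have -> : u ^+ 2 / x - a ^+ 2 * x = (a + u / x) * (u - a * x) by field.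
  rewrite normrM; apply: (@le_trans _ _ ((`|a| + c) * (eps / (`|a| + c + 1) * `|h|))).
    apply: ler_pM => //; apply: le_trans (ler_normD _ _) _; rewrite lerD2l.
    by rewrite normf_div ler_pdivrMr // normr_gt0.
  rewrite mulrA ler_wpM2r // mulrCA ler_piMr ?(ltW eps0) //.
  by rewrite ler_pdivrMr // mul1r lerDl.
have dG : 'd G p = LL :> (V -> K) by apply: diff_unique.
by apply/diff_locallyP; rewrite dG; split.
Qed.

End SquareQuotient.

Section Evaluation.
Context {R : realType} {d : nat}.
Local Notation C := (Cplx R).
Local Notation Re := (@complex.Re R).
Local Notation Im := (@complex.Im R).
Implicit Types (F : 'rV[C]_d -> C) (p z : 'rV[C]_d) (j : 'I_d).

Definition freeze j (l : C) z : 'rV[C]_d := \row_k (if k == j then l else z ord0 k).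

Lemma freeze_id j z : freeze j (z ord0 j) z = z.
Proof. by apply/rowP => k; rewrite mxE; case: eqP => // ->. Qed.

Lemma freeze_freeze j l m z : freeze j l (freeze j m z) = freeze j l z.
Proof. by apply/rowP => k; rewrite !mxE; case: eqP. Qed.

Lemma freezeE j l z : freeze j l z = z + (l - z ord0 j) *: delta_mx ord0 j.
Proof.
apply/rowP => k; rewrite !mxE eqxx /=; case: eqP => [->|_].
  by rewrite mulr1 addrC subrK.
by rewrite mulr0 addr0.
Qed.

Lemma differentiable_freeze j l z : differentiable (freeze j l) z.
Proof.
have -> : freeze j l = (fun z => z + (l - z ord0 j) *: delta_mx ord0 j).
  by apply/funext => y; exact: freezeE.
apply: differentiableD => //; apply: differentiableZl.
by apply: differentiableB; [exact: differentiable_cst|exact: differentiable_coord].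
Qed.

Lemma derivable_slice F j z l : differentiable F (freeze j l z) ->
  derivable (fun x : C => F (freeze j x z)) l 1.
Proof.
move=> dF; apply/derivable1_diffP.
apply: (@differentiable_comp _ _ _ _ (fun x => freeze j x z) F) => //.
have -> : (fun x => freeze j x z) = (fun x => z + (x - z ord0 j) *: delta_mx ord0 j).
  by apply/funext => y; exact: freezeE.
apply: differentiableD; first exact: differentiable_cst.
by apply: differentiableZl; apply: differentiableB => //; exact: differentiable_cst.
Qed.

(** The radius [r] will exceed [1], so that these functions are differentiable at
    the boundary points of the closed polydisc as well. *)
Definition tame (r M : R) F := forall z, (forall j, cabs (z ord0 j) < r) ->
  differentiable F z /\ cabs (F z) <= M.

Lemma tame_pd r M F : 1 < r -> tame r M F -> polydisc_algebra F.
Proof.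
move=> r1 tF.
have dF z : closed_polydisc z -> differentiable F z.
  by move=> /closed_polydiscE h; have [] := tF z (fun j => le_lt_trans (h j) r1).
split=> [z /sub_closed_polydisc/dF //|].
apply/subspace_continuousP => z /dF /differentiable_continuous cF.
exact: cvg_within_filter.
Qed.

Lemma tame_freeze r M F j l : cabs l < r -> tame r M F -> tame r M (F \o freeze j l).
Proof.
move=> lr tF z zr.
have fr k : cabs (freeze j l z ord0 k) < r by rewrite mxE; case: eqP.
have [dF bF] := tF _ fr; split; last exact: bF.
by apply: differentiable_comp; [exact: differentiable_freeze|exact: dF].
Qed.

Lemma near_coords r p : (forall j, cabs (p ord0 j) < r) ->
  \near p, forall j, cabs ((p : 'rV[C]_d) ord0 j) < r.
Proof.
move=> pr; have := @filter_forall 'rV[C]_d 'I_d (fun j => [set z | cabs (z ord0 j) < r])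
  (nbhs p) _; apply=> j.
have rp : 0 < r - cabs (p ord0 j) by rewrite subr_gt0.
apply/nbhs_rvP; exists (r - cabs (p ord0 j)) => // z /(_ j).
by have := cabsD (z ord0 j - p ord0 j) (p ord0 j); rewrite subrK /=; lra.
Qed.

(** The difference [g] of [F] and of [F] with one coordinate frozen vanishes on
    a hyperplane, and the Schwarz lemma on the lines transverse to it bounds
    [g] by the distance to the hyperplane. *)
Lemma differentiable_freeze_quotient r M F j l p : cabs l < r -> tame r M F ->
  (forall k, cabs (p ord0 k) < r) ->
  differentiable (fun z => (F z - F (freeze j l z)) ^+ 2 / (z ord0 j - l)) p.
Proof.
move=> lr tF pr; pose g z := F z - F (freeze j l z).
have dg z : (forall k, cabs (z ord0 k) < r) -> differentiable g z.
  move=> zr; have [dF _] := tF z zr; have [dF' _] := tame_freeze j lr tF zr.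
  exact: differentiableB.
have [pl|pl] := eqVneq (p ord0 j) l; last first.
  apply: differentiableM; first by apply: differentiable_pow; exact: dg.
  apply: differentiableV; last by rewrite subr_eq0.
  by apply: differentiableB; [exact: differentiable_coord|exact: differentiable_cst].
have lin : linear (fun z : 'rV[C]_d => z ord0 j) by move=> a u v; rewrite !mxE.
pose mlin := GRing.isLinear.Build _ _ _ _ _ lin.
pose ell : {linear 'rV[C]_d -> C} := HB.pack (fun z : 'rV[C]_d => z ord0 j) mlin.
pose s := (r - cabs l) / 3.
have s0 : 0 < s by rewrite divr_gt0 // subr_gt0.
have M0 : 0 <= M by have [_] := tF p pr; apply: le_trans; exact: cabs_ge0.
have := @differentiable_square_quotient _ _ ell g p (delta_mx ord0 j) (ofR (2 * M / s)).
rewrite /ell /= pl; apply.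
- exact: coord_continuous.
- by rewrite mxE !eqxx.
- by move=> v vl; rewrite /g -vl freeze_id subrr.
- exact: dg.
- by rewrite ofR_ge0; apply: divr_ge0; [rewrite mulr_ge0|exact: ltW].
have near_s : \near p, cabs ((p : 'rV[C]_d) ord0 j - l) < s.
  by apply/nbhs_rvP; exists s => // z /(_ j); rewrite pl.
apply: filterS2 (near_coords pr) near_s => z zr zs.
rewrite !normE -rmorphM ofR_le.
have zj : g (freeze j (z ord0 j) z) = g z by rewrite freeze_id.
rewrite -zj; apply: (@schwarz R (fun x => g (freeze j x z)) l s (2 * M)) => //.
  by rewrite /g freeze_freeze subrr.
move=> x x1 x2.
have xr : cabs x < r.
  have := cabsD (x - l) l; rewrite subrK.
  have := cabs_le_ReIm (x - l); rewrite !ReIm.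
  by rewrite /s in x1 x2 *; lra.
have fr k : cabs (freeze j x z ord0 k) < r by rewrite mxE; case: eqP.
split; first by apply: derivable_slice; exact: dg.
have [_ b1] := tF _ fr; have [_ b2] := tame_freeze j lr tF fr.
apply: le_trans (cabsD _ _) _; rewrite cabsN; move: b2 => /=; lra.
Qed.

Section Characters.
Local Notation A := (@pdalg R d).
Variable phi : {rmorphism A -> C}.
Hypothesis phi_scalar : forall c, phi (pd_scalar c) = c.
Hypothesis phi_le : forall a, cabs (phi a) <= pdnorm a.

Definition eval_point : 'rV[C]_d := \row_j phi (pd_of (pd_coord j)).

Lemma eval_point_le1 j : cabs (eval_point ord0 j) <= 1.
Proof.
rewrite mxE; apply: le_trans (phi_le _) _; apply: pdnorm_le => z.
by move=> /closed_polydiscE/(_ j).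
Qed.

(** With [g = a - b], the square [g ^ 2] is a multiple of [z_j - l_j], which [phi]
    kills by the definition of [l_j]. *)
Lemma character_freeze r M F j (a b : A) : 1 < r -> tame r M F ->
  a = F :> (_ -> _) -> b = F \o freeze j (eval_point ord0 j) :> (_ -> _) ->
  phi a = phi b.
Proof.
move=> r1 tF aF bF; set l := eval_point ord0 j in bF.
have lr : cabs l < r := le_lt_trans (eval_point_le1 j) r1.
pose G z := (F z - F (freeze j l z)) ^+ 2 / (z ord0 j - l).
have dG z : closed_polydisc z -> differentiable G z.
  move=> /closed_polydiscE zD; apply: differentiable_freeze_quotient lr tF _ => k.
  exact: le_lt_trans (zD k) r1.
have pdG : polydisc_algebra G.
  split=> [z /sub_closed_polydisc/dG //|].
  apply/subspace_continuousP => z /dG /differentiable_continuous cG.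
  exact: cvg_within_filter.
have E : (a - b) ^+ 2 = (pd_of (pd_coord j) - pd_scalar l) * pd_of pdG.
  apply: val_inj; apply/funext => z.
  transitivity ((a z - b z) * (a z - b z)) => //.
  transitivity ((z ord0 j - l) * G z) => //.
  rewrite aF bF /G /=; have [zl|zl] := eqVneq (z ord0 j) l.
    have -> : freeze j l z = z by rewrite -zl freeze_id.
    by rewrite subrr expr0n /= !mul0r mulr0.
  by field; rewrite subr_eq0.
have : phi ((a - b) ^+ 2) = 0.
  by rewrite E rmorphM rmorphB phi_scalar /l /eval_point mxE subrr mul0r.
by rewrite rmorphXn rmorphB => /eqP; rewrite expf_eq0 /= subr_eq0 => /eqP.
Qed.

Let partial_freeze (m : nat) z : 'rV[C]_d :=
  \row_k (if (k < m)%N then eval_point ord0 k else z ord0 k).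

(** The coordinates are frozen one after the other, until the function is
    constant. *)
Lemma character_tame r M F (a : A) : 1 < r -> tame r M F ->
  a = F :> (_ -> _) -> phi a = F eval_point.
Proof.
move=> r1 tF aF.
have lr k : cabs (eval_point ord0 k) < r := le_lt_trans (eval_point_le1 k) r1.
have step m : (m <= d)%N -> tame r M (F \o partial_freeze m) /\
    forall b : A, b = F \o partial_freeze m :> (_ -> _) -> phi a = phi b.
  elim: m => [|m IH] md.
    have -> : F \o partial_freeze 0 = F.
      by apply/funext => z /=; congr F; apply/rowP => k; rewrite mxE ltn0.
    split=> // b bF; have -> : b = a by apply: val_inj; rewrite /= aF bF.
    by [].
  have [tm hm] := IH (ltnW md).
  pose j := Ordinal md.
  have E : F \o partial_freeze m.+1 =
      (F \o partial_freeze m) \o freeze j (eval_point ord0 j).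
    apply/funext => z /=; congr F; apply/rowP => k; rewrite !mxE ltnS leq_eqVlt.
    rewrite -(inj_eq val_inj) /=; case: (ltngtP k m) => //= km.
    by rewrite (_ : k = j) //; exact: val_inj.
  rewrite E; split=> [|b bF]; first exact: tame_freeze.
  rewrite (hm (pd_of (tame_pd r1 tm))) //.
  exact: (character_freeze r1 tm _ bF).
have [_ h] := step d (leqnn d).
rewrite (h (pd_scalar (F eval_point))) ?phi_scalar //.
apply/funext => z /=; congr F; apply/rowP => k.
by rewrite [RHS]mxE ltn_ord.
Qed.

Theorem character_eval (f : A) : phi f = f eval_point.
Proof.
have lD : closed_polydisc eval_point by apply/closed_polydiscE; exact: eval_point_le1.
apply/eqP; rewrite -subr_eq0 -cabs_eq0 eq_le cabs_ge0 andbT.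
apply/ler_addgt0Pr => e e0; rewrite add0r.
have e2 : 0 < e / 2 by rewrite divr_gt0.
have [t /andP[t0 t1] ht] := dilation_approx (pdP f).2 e2.
have it1 : 1 < t^-1 by rewrite invf_gt1.
have td z : (forall k, cabs (z ord0 k) < t^-1) -> polydisc (ofR t *: z).
  move=> zt; apply/polydiscE => k; rewrite mxE cabsM cabs_real ?ltW //.
  by rewrite mulrC -ltr_pdivlMr // mul1r.
have tF : tame t^-1 (pdnorm f) (fun z => f (ofR t *: z)).
  move=> z /td zD; split; last by apply: le_pdnorm; exact: sub_closed_polydisc.
  apply: (@differentiable_comp _ _ _ _ (fun z => ofR t *: z) f).
    exact: differentiableZ.
  exact: (pdP f).1.
pose b := pd_of (tame_pd it1 tF).
have pb : phi b = f (ofR t *: eval_point) by exact: (character_tame it1 tF).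
have h1 : cabs (phi f - phi b) <= e / 2.
  rewrite -rmorphB; apply: le_trans (phi_le _) _; apply: pdnorm_le => z zD.
  exact: ht.
have h2 := ht _ lD; rewrite cabsB -pb in h2.
have := cabsD (phi f - phi b) (phi b - f eval_point).
by rewrite addrA subrK; lra.
Qed.

End Characters.
End Evaluation.

(** * The corona theorem and symmetrization *)

Section Corona.
Context {R : realType} {d : nat}.
Local Notation C := (Cplx R).
Local Notation A := (@pdalg R d).

Lemma pd_sumE (I : Type) (r : seq I) (P : pred I) (a : I -> A) z :
  (\sum_(i <- r | P i) a i) z = \sum_(i <- r | P i) a i z.
Proof. exact: (big_morph (fun a : A => a z)). Qed.

Lemma pd_eq0 (f : 'rV[C]_d -> C) : polydisc_algebra f ->
  (forall z, polydisc z -> f z = 0) -> forall z, closed_polydisc z -> f z = 0.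
Proof.
move=> [_ /subspace_continuousP fc] f0 z zD.
apply/eqP; rewrite -cabs_eq0 eq_le cabs_ge0 andbT.
apply/ler_addgt0Pr => e e0; rewrite add0r.
have : nbhs (f z) [set w : C | cabs (w - f z) < e] by apply/nbhs_cabsP; exists e.
move=> /(fc z zD) /(polydisc_dense zD) [y yD] /(_ (sub_closed_polydisc yD)) h.
have : cabs (f y - f z) < e by exact: h.
by rewrite f0 // sub0r cabsN => /ltW.
Qed.

(** Otherwise some character vanishes on the ideal generated by the [f k]; it is
    the evaluation at a common zero [l] of the [f k] in the closed polydisc, and
    near [l] there are points of the open polydisc where the sum is small. *)
Theorem corona n (f : 'I_n -> A) (delta : R) : 0 < delta ->
  (forall z, polydisc z -> delta <= \sum_(k < n) cabs (f k z)) ->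
  exists g : 'I_n -> A, forall z, closed_polydisc z -> \sum_(k < n) f k z * g k z = 1.
Proof.
move=> d0 fd.
pose I : set A := [set a | exists g : 'I_n -> A,
  forall z, closed_polydisc z -> a z = \sum_(k < n) f k z * g k z].
suff [g hg] : I 1 by exists g => z /hg <-.
apply: contrapT => I1.
have I0 a : pdnorm a = 0 -> I a.
  move=> /pdnorm_eq0 a0; exists (fun=> 0) => z /a0 ->.
  by rewrite big1 // => k _; rewrite mulr0.
have pI : proper_ideal_set I.
  split=> // [|a b c [g hg] [h hh]].
    by apply: I0; apply/pdnorm_eq0.
  exists (fun k => a * g k + h k) => z zD.
  transitivity (a z * b z + c z) => //; rewrite hg // hh // big_distrr -big_split /=.
  apply: eq_bigr => k _; transitivity (f k z * (a z * g k z + h k z)) => //.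
  by rewrite mulrDr mulrCA.
have [phi [phi_sc phi_le phiI]] := character_exists
  (@pdnorm_ge0 R d) (@pdnormD R d) (@pdnormM R d) (@pdnorm_scalar R d)
  (@pdnorm_inv R d) pI I0.
have fl k : f k (eval_point phi) = 0.
  rewrite -character_eval //; apply: phiI; exists (fun i => (i == k)%:R) => z zD.
  rewrite (bigD1 k) //= eqxx big1 ?addr0.
    by transitivity (f k z * 1) => //; rewrite mulr1.
  by move=> i /negPf ->; transitivity (f i z * 0) => //; rewrite mulr0.
set l := eval_point phi in fl.
have lD : closed_polydisc l by apply/closed_polydiscE; exact: eval_point_le1.
have e0 : 0 < delta / n.+1%:R by rewrite divr_gt0.
have near_l : \forall z \near within closed_polydisc (nbhs l),
    forall k, cabs (f k z) < delta / n.+1%:R.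
  have := @filter_forall 'rV[C]_d 'I_n (fun k => [set z | cabs (f k z) < delta / n.+1%:R])
    (within closed_polydisc (nbhs l)) _; apply=> k.
  have /subspace_continuousP/(_ l lD) fc := (pdP (f k)).2.
  have : nbhs (f k l) [set w : C | cabs w < delta / n.+1%:R].
    by apply/nbhs_cabsP; exists (delta / n.+1%:R) => // w; rewrite fl subr0.
  by move=> /fc.
have [y yD /(_ (sub_closed_polydisc yD)) hy] := polydisc_dense lD near_l.
have := fd y yD; apply/negP; rewrite -ltNge.
apply: (@le_lt_trans _ _ (\sum_(k < n) delta / n.+1%:R)).
  by apply: ler_sum => k _; exact/ltW/hy.
rewrite sumr_const card_ord -[X in X < _]mulr_natr mulrAC ltr_pdivrMr ?ltr0n //.
by rewrite ltr_pM2l // ltr_nat.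
Qed.

Lemma col_perm_closed_polydisc (s : 'S_d) (z : 'rV[C]_d) :
  closed_polydisc z -> closed_polydisc (col_perm s z).
Proof. by move=> h j; rewrite mxE; exact: h. Qed.

Lemma pd_col_perm (s : 'S_d) (f : 'rV[C]_d -> C) : polydisc_algebra f ->
  polydisc_algebra (fun z => f (col_perm s z)).
Proof.
have cs : continuous (col_perm s : 'rV[C]_d -> 'rV[C]_d).
  move=> z B /nbhs_rvP [e e0 eB]; apply/nbhs_rvP; exists e => // y yz.
  by apply: eB => j; rewrite !mxE.
move=> [df cf]; split=> [z zD|].
  apply: (@differentiable_comp _ _ _ _ (col_perm s : 'rV[C]_d -> 'rV[C]_d) f).
    exact: linear_differentiable.
  by apply: df => j; rewrite mxE; exact: zD.
move/subspace_continuousP : cf => cf; apply/subspace_continuousP => z zD B hB.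
have nB : nbhs (col_perm s z) [set y | closed_polydisc y -> B (f y)].
  exact: (cf _ (col_perm_closed_polydisc zD) B hB).
have /nbhs_rvP [e e0 eB] := nB; apply/nbhs_rvP; exists e => // y yz yD.
apply: eB; last exact: col_perm_closed_polydisc.
by move=> j; rewrite !mxE.
Qed.

Lemma symmetric_closed (f : 'rV[C]_d -> C) : sym_polydisc_algebra f ->
  forall (s : 'S_d) z, closed_polydisc z -> f (col_perm s z) = f z.
Proof.
move=> [fA fsym] s z zD; apply/eqP; rewrite -subr_eq0; apply/eqP.
apply: (pd_eq0 (pd_sub (pd_col_perm s fA) fA)) zD => y yD.
by rewrite fsym // subrr.
Qed.

Definition symmetrize (f : A) : A :=
  pd_scalar (d`!%:R)^-1 * \sum_(s : 'S_d) pd_of (pd_col_perm s (pdP f)).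

Lemma symmetrizeE (f : A) z :
  symmetrize f z = (d`!%:R)^-1 * \sum_(s : 'S_d) f (col_perm s z).
Proof.
transitivity ((d`!%:R)^-1 * (\sum_(s : 'S_d) pd_of (pd_col_perm s (pdP f))) z) => //.
by rewrite pd_sumE.
Qed.

Lemma symmetrize_sym (f : A) : sym_polydisc_algebra (symmetrize f).
Proof.
split; first exact: pdP.
move=> z zD t; rewrite !symmetrizeE; congr (_ * _).
rewrite [RHS](reindex_inj (mulIg t)) /=; apply: eq_bigr => s _; congr (f _).
by apply/rowP => j; rewrite !mxE permM.
Qed.

Lemma symmetrize_bezout n (f : 'I_n -> 'rV[C]_d -> C) (g : 'I_n -> A) :
  (forall k, sym_polydisc_algebra (f k)) ->
  (forall z, closed_polydisc z -> \sum_(k < n) f k z * g k z = 1) ->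
  forall z, closed_polydisc z -> \sum_(k < n) f k z * symmetrize (g k) z = 1.
Proof.
move=> fsym fg z zD.
transitivity (\sum_(k < n) (d`!%:R)^-1 *
   \sum_(s : 'S_d) f k (col_perm s z) * g k (col_perm s z)).
  apply: eq_bigr => k _; rewrite symmetrizeE mulrCA; congr (_ * _).
  by rewrite big_distrr; apply: eq_bigr => s _; rewrite /= (symmetric_closed (fsym k)).
rewrite -big_distrr exchange_big /= (eq_bigr (fun=> 1)); last first.
  by move=> s _; apply: fg; exact: col_perm_closed_polydisc.
rewrite sumr_const card_Sn mulVf // pnatr_eq0 -lt0n; exact: fact_gt0.
Qed.

End Corona.

Theorem theorem2p1 (R : realType) (d n : nat) (d_gt0 : (0 < d)%N)
    (n_gt0 : (0 < n)%N) (f : 'I_n -> 'rV[Cplx R]_d -> Cplx R)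
    (f_sym : forall k : 'I_n, sym_polydisc_algebra (f k)) :
  (exists g : 'I_n -> 'rV[Cplx R]_d -> Cplx R,
      (forall k : 'I_n, sym_polydisc_algebra (g k)) /\
      (forall z : 'rV[Cplx R]_d, closed_polydisc z ->
         \sum_(k < n) f k z * g k z = 1))
  <->
  (exists delta : R, 0 < delta /\
      (forall z : 'rV[Cplx R]_d, polydisc z ->
         (delta%:C)%C <= \sum_(k < n) `|f k z|)).
Proof.
have normS z : \sum_(k < n) `|f k z| = ofR (\sum_(k < n) cabs (f k z)).
  by rewrite rmorph_sum; apply: eq_bigr => k _; exact: normE.
split=> [[g [g_sym fg]]|[delta [d0 fd]]].
  pose G k : pdalg := pd_of (g_sym k).1.
  pose B := 1 + \sum_(k < n) pdnorm (G k).
  have B0 : 0 < B by rewrite ltr_wpDr // sumr_ge0 // => k _; exact: pdnorm_ge0.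
  exists B^-1; rewrite invr_gt0; split=> // z /sub_closed_polydisc zD.
  rewrite normS -[X in X <= _]/(ofR B^-1) ofR_le -[B^-1]mul1r ler_pdivrMr //.
  rewrite -(@cabs1 R) -(fg z zD); apply: le_trans (cabs_sum _ _ _) _.
  rewrite big_distrl; apply: ler_sum => k _ /=; rewrite cabsM ler_wpM2l ?cabs_ge0 //.
  apply: le_trans (le_pdnorm (G k) zD) _; rewrite /B (bigD1 k) //= addrCA lerDl.
  by rewrite addr_ge0 // sumr_ge0 // => i _; exact: pdnorm_ge0.
have [z zD|g fg] := @corona R d n (fun k => pd_of (f_sym k).1) delta d0.
  by have := fd z zD; rewrite normS -[X in X <= _]/(ofR delta) ofR_le.
exists (fun k => symmetrize (g k)); split=> [k|]; first exact: symmetrize_sym.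
exact: symmetrize_bezout.
Qed.
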